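(* Let $n,m\in\mathbb{N}$ with $m\ge 4$, and let $X_1,\dots,X_n$ be independent random variables, each uniformly distributed on $[m]=\{1,\dots,m\}$ (the uniform case). Let $Y$ be the number of non-isolated balls, with mean $\mu_Y$ and standard deviation $\sigma_Y>0$. If $\sigma_Y^3\ge 24\mu_Y$, then $$D_Y\le \frac{0.8}{\sigma_Y}+\left(\frac{\mu_Y}{\sigma_Y^2}\right)\left(\frac{256}{\sigma_Y}+\frac{32}{\sigma_Y^2}+23\sqrt{\eta(n,m)}\right),$$ where $$\eta(n,m):=\frac{16}{n}+\frac{4}{n(n-1)}+\frac{24}{m}\left(2+\frac{n}{m-3}+\frac{n}{m}\right).$$
   Context: For $1\le i\le n$ let $M_i:=-1+\sum_{j=1}^n\mathbf{1}\{X_j=X_i\}$ (the number of other balls in the same urn as ball $i$). The number of non-isolated balls is $Y:=\sum_{i=1}^n\mathbf{1}\{M_i>0\}$. For a random variable $W$ with finite mean $\mu_W$ and standard deviation $\sigma_W\in(0,\infty)$, $D_W:=\sup_{t\in\mathbb{R}}\left|P\left[\frac{W-\mu_W}{\sigma_W}\le t\right]-\Phi(t)\right|$, where $\Phi$ is the standard normal distribution function. *)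

(* Defs.v *)
From HB Require Import structures.
From mathcomp Require Import all_boot all_order all_algebra.
From mathcomp Require Import all_classical all_reals all_analysis.

Set Implicit Arguments.
Unset Strict Implicit.
Unset Printing Implicit Defensive.

Import Order.TTheory GRing.Theory Num.Theory.
Import numFieldNormedType.Exports.

Local Open Scope classical_set_scope.
Local Open Scope ring_scope.

Section probability_notions.
Context d (T : measurableType d) (R : realType) (P : probability T R).

Definition mutually_independent d' (T' : measurableType d') (I : finType)
    (X : I -> {RV P >-> T'}) : Prop :=
  forall (J : {set I}) (A : I -> set T'), (forall i, measurable (A i)) ->
    P (\bigcap_(i in [set` J]) (X i @^-1` A i)) =
    (\prod_(i in J) P (X i @^-1` A i))%E.

(* [m] = {1, ..., m}; only the law of X is constrained, so X may leave [m] on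
   a null set. *)
Definition uniform_on (m : nat) (X : {RV P >-> nat}) : Prop :=
  forall k : nat, distribution P X [set k] =
    (if (1 <= k <= m)%N then m%:R^-1 else 0)%:E.

(* mean and sd return junk values on infinite moments (through [fine]); they
   are only applied to bounded random variables. *)
Definition mean (W : T -> R) : R := fine 'E_P[W]%E.

Definition sd (W : T -> R) : R := Num.sqrt (fine 'V_P[W]%E).

Definition std_normal_cdf (t : R) : R := fine (normal_prob 0 1 `]-oo, t]).

Definition normal_discrepancy (W : T -> R) : R :=
  sup [set `| fine (P [set w | (W w - mean W) / sd W <= t])
              - std_normal_cdf t | | t in [set: R]].

End probability_notions.

Section urns.
Context (T : Type) (n : nat) (X : 'I_n -> T -> nat).

Definition cohabitants (i : 'I_n) (w : T) : int :=
  -1 + \sum_(j < n) (X j w == X i w)%:Z.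

Definition non_isolated (R : realType) (w : T) : R :=
  \sum_(i < n) (0 < cohabitants i w)%R%:R.

End urns.

Definition urn_eta (R : realType) (n m : nat) : R :=
  16 / n%:R + 4 / (n%:R * (n%:R - 1)) +
  24 / m%:R * (2 + n%:R / (m%:R - 3) + n%:R / m%:R).

(* Main.v *)
(* Stein's method with an explicit coupling.  Write [q = 1 - 1/m].  Revealing the
   other balls one by one, the event that ball [i] is not isolated telescopes
   into a sum over [j] of the events that ball [j] is the first to join ball [i],
   and exchanging the position of [j] with an independent copy gives, for all [F],
     E[(Y - mu) F(Y)] = sum_(i,j) E[w_ij (F(Y^(j->i)) - F(Y))],
   where [Y^(j->i)] is the count after ball [j] has been moved to the urn of ball
   [i], the weights satisfy [sum_(i,j) w_ij <= mu] pointwise, and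
   [|Y^(j->i) - Y| <= 2].  Solving Stein's equation for ramps of width
   [4 kappa], [kappa = 4 mu / sigma^3], bounds the discrepancy [D] by
   [D / 2 + 14 kappa + 2 sqrt(Var D') / sigma^2], where
   [D' = sum_(i,j) w_ij (Y^(j->i) - Y)]; the term [D / 2], which comes from the
   probability that [Y] falls in the ramp, is absorbed.  Finally the Efron-Stein
   inequality yields [Var D' <= 16 mu^2 eta(n, m)]. *)
Require Import Defs.
From HB Require Import structures.
From mathcomp Require Import all_boot all_order all_algebra.
From mathcomp Require Import all_classical all_reals all_analysis.
From mathcomp Require Import measurable_realfun.
From mathcomp Require Import ring lra.

Set Implicit Arguments.
Unset Strict Implicit.
Unset Printing Implicit Defensive.

Import Order.TTheory GRing.Theory Num.Theory.
Import numFieldNormedType.Exports.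

Local Open Scope classical_set_scope.
Local Open Scope ring_scope.

(** * Gaussian integrals *)

Section gaussian_integrals.
Context {R : realType}.
Implicit Types (x w : R) (h : R -> R).
Local Notation leb := (@lebesgue_measure R).
Local Notation phi := (normal_pdf (0 : R) 1).
Local Notation Phi := (@std_normal_cdf R).

Lemma normal_pdf01E x : phi x = normal_peak 1 * expR (- x ^+ 2 / 2).
Proof. by rewrite normal_pdfE ?oner_neq0// /normal_fun subr0 expr1n. Qed.

Lemma normal_pdf01_gt0 x : 0 < phi x.
Proof. by rewrite normal_pdf01E mulr_gt0 ?expR_gt0// normal_peak_gt0 ?oner_neq0. Qed.

Lemma is_derive_normal_pdf01 x : is_derive x 1 phi (- x * phi x).
Proof.
have -> : phi = normal_peak 1 \*: (expR \o (- 2^-1 \*: (id ^+ 2))).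
  apply/funext => t /=; rewrite normal_pdf01E; congr (_ * expR _).
  by rewrite /GRing.scale/= mulrC mulNr mulrN.
apply: is_derive_eq.
rewrite /= /GRing.scale/= expr1; set e := expR _; set p := normal_peak 1; by field.
Qed.

Lemma normal_pdf01_le1 x : phi x <= 1.
Proof.
rewrite (le_trans (normal_pdf_ub _ _ _)) ?oner_neq0// /normal_peak expr1n mul1r.
rewrite invf_le1; last by rewrite sqrtr_gt0 pmulrn_lgt0// pi_gt0.
by rewrite -[leLHS]sqrtr1 ler_wsqrtr// -mulr_natr; have := @pi_ge2 R; lra.
Qed.

Lemma normal_pdf01_ge x : `|x| <= 1 -> 6^-1 <= phi x.
Proof.
move=> x1; rewrite normal_pdf01E.
(* The factor 1/3 bounds the peak, because [2 * pi] is below 9; the factor 1/2 bounds the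
   exponential through [1 + u <= expR u]. *)
have -> : 6^-1 = 3^-1 * 2^-1 :> R by lra.
apply: ler_pM; rewrite ?invr_ge0//.
  rewrite /normal_peak expr1n mul1r lef_pV2 ?posrE//; last first.
    by rewrite sqrtr_gt0 pmulrn_lgt0// pi_gt0.
  have -> : 3 = Num.sqrt (3 ^+ 2) :> R by rewrite sqrtr_sqr ger0_norm.
  by rewrite ler_wsqrtr// -mulr_natr expr2; have := @pihalf_lt2 R; lra.
apply: le_trans (expR_ge1Dx _).
have : x ^+ 2 <= 1 by rewrite -real_normK ?num_real// expr_le1.
lra.
Qed.

Definition gauss_cdf h x := (\int[leb]_(t in `]-oo, x]) (h t * phi t))%R.
Definition gauss_mean h := (\int[leb]_t (h t * phi t))%R.

Lemma std_normal_cdfE : Phi = gauss_cdf (cst 1).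
Proof.
apply/funext => x; rewrite /gauss_cdf; under eq_Rintegral do rewrite mul1r.
by [].
Qed.

Section weight.
Variable h : R -> R.
Hypotheses (ch : continuous h) (h01 : forall x, 0 <= h x <= 1).

Let hphi_ge0 t : 0 <= h t * phi t.
Proof. by rewrite mulr_ge0 ?normal_pdf_ge0//; case/andP: (h01 t). Qed.

Let hphi_le t : h t * phi t <= phi t.
Proof. by rewrite ler_piMl ?normal_pdf_ge0//; case/andP: (h01 t). Qed.

Let chphi : continuous (fun t => h t * phi t).
Proof.
by move=> t; apply: cvgM; [exact: ch|apply: continuous_normal_pdf; exact: oner_neq0].
Qed.

Lemma integrable_gauss (A : set R) : measurable A ->
  leb.-integrable A (EFin \o (fun t => h t * phi t)).
Proof.
move=> mA; apply: (@integrableS _ _ _ _ setT) => //.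
apply: (le_integrable _ _ _ (integrable_normal_pdf 0 1)) => //.
  apply/measurable_EFinP; exact: continuous_measurable_fun.
by move=> t _ /=; rewrite lee_fin !ger0_norm ?normal_pdf_ge0.
Qed.

Lemma is_derive_gauss_cdf x : is_derive x 1 (gauss_cdf h) (h x * phi x).
Proof.
have [||||dF Fx] := @continuous_FTC1 R (fun t => h t * phi t) -oo%O x (x + 1).
- by rewrite ltrDl.
- exact: integrable_gauss.
- by rewrite ltNyr.
- exact: chphi.
by apply: (DeriveDef dF); rewrite -derive1E.
Qed.

Lemma gauss_cdf_ge0 x : 0 <= gauss_cdf h x.
Proof. by apply: Rintegral_ge0 => t _; exact: hphi_ge0. Qed.

Lemma gauss_mean_ge x : gauss_cdf h x <= gauss_mean h.
Proof.
rewrite -subr_ge0 /gauss_mean -set_itvNyy Rintegral_itvB//; last first.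
  by rewrite set_itvNyy; exact: integrable_gauss.
by apply: Rintegral_ge0 => t _; exact: hphi_ge0.
Qed.

End weight.

(** Both tails are compared at once: with [h2] constant equal to 1, they control the numerator of
    the Stein solution from either end of the line. *)
Lemma le_gauss_cdf h1 h2 x : continuous h1 -> continuous h2 ->
  (forall t, 0 <= h1 t) -> (forall t, h1 t <= h2 t) -> (forall t, h2 t <= 1) ->
  gauss_cdf h1 x <= gauss_cdf h2 x /\
  gauss_mean h1 - gauss_cdf h1 x <= gauss_mean h2 - gauss_cdf h2 x.
Proof.
move=> c1 c2 h10 h12 h21.
have h1b t : 0 <= h1 t <= 1 by rewrite h10 (le_trans (h12 t)).
have h2b t : 0 <= h2 t <= 1 by rewrite h21 (le_trans (h10 t)).
have le12 t : h1 t * phi t <= h2 t * phi t by rewrite ler_wpM2r ?normal_pdf_ge0.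
split; first by apply: le_Rintegral => //; exact: integrable_gauss.
rewrite /gauss_mean -set_itvNyy !Rintegral_itvB//; last 2 first.
- by rewrite set_itvNyy; exact: integrable_gauss.
- by rewrite set_itvNyy; exact: integrable_gauss.
by apply: le_Rintegral => //; exact: integrable_gauss.
Qed.

Lemma gauss_mean1 : gauss_mean (cst 1) = 1.
Proof.
rewrite /gauss_mean /Rintegral; under eq_integral do rewrite mul1r.
by rewrite integral_normal_pdf.
Qed.

Lemma std_normal_cdf_ge0 x : 0 <= Phi x.
Proof. by rewrite std_normal_cdfE gauss_cdf_ge0// => t; rewrite ler01 lexx. Qed.

Lemma std_normal_cdf_le1 x : Phi x <= 1.
Proof.
rewrite std_normal_cdfE -[leRHS]gauss_mean1 gauss_mean_ge// => [y|t].
- exact: cvg_cst.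
- by rewrite ler01 lexx.
Qed.

Lemma is_derive_std_normal_cdf x : is_derive x 1 Phi (phi x).
Proof.
rewrite std_normal_cdfE -[phi x]mul1r; apply: is_derive_gauss_cdf => [y|t].
- exact: cvg_cst.
- by rewrite ler01 lexx.
Qed.

End gaussian_integrals.

(** * The Stein equation of the normal law *)

Lemma MVT_global (R : realType) (f df : R -> R) (a b : R) : a <= b ->
  (forall x, is_derive x (1 : R) f (df x)) ->
  exists c, [/\ a <= c, c <= b & f b - f a = df c * (b - a)].
Proof.
move=> ab fdf; have [|c] := MVT_segment ab (fun x _ => fdf x); last first.
- by rewrite in_itv/= => /andP[ac cb] ->; exists c.
by apply: derivable_within_continuous => x _; have [] := fdf x.
Qed.

Section stein_equation.
Context {R : realType}.
Implicit Types (x w : R) (h : R -> R).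
Local Notation phi := (normal_pdf (0 : R) 1).
Local Notation Phi := (@std_normal_cdf R).

Lemma std_normal_cdf_lip (a b : R) : a <= b -> 0 <= Phi b - Phi a <= b - a.
Proof.
move=> ab; have [c [ac cb ->]] := MVT_global ab is_derive_std_normal_cdf.
rewrite mulr_ge0 ?normal_pdf_ge0 ?subr_ge0//=.
by rewrite ler_piMl ?subr_ge0// normal_pdf01_le1.
Qed.

Lemma std_normal_cdf_cvg :
  Phi x @[x --> -oo] --> (0 : R) /\ Phi x @[x --> +oo] --> (1 : R).
Proof.
(* [Phi] is the distribution function of the identity under the normal law, so its limits are those
   of any distribution function. *)
pose X : {RV (normal_prob (0 : R) 1) >-> R} := HB.pack (idfun : measurableTypeR R -> R)
  (@isMeasurableFun.Build _ _ _ _ (idfun : measurableTypeR R -> R) (@measurable_id _ _ setT)).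
have := @cvg_cdfNy0 _ _ _ (normal_prob (0 : R) 1) X.
have := @cvg_cdfy1 _ _ _ (normal_prob (0 : R) 1) X.
by move=> /fine_cvg ? /fine_cvg ?.
Qed.

(* The derivative of [phi + w * Phi] is [(w - t) * phi t]. *)
Lemma pdf_cdf_max w t : phi t + w * Phi t <= phi w + w * Phi w.
Proof.
have dg x : is_derive x 1 (phi + w \*: Phi) ((w - x) * phi x).
  have h1 := is_derive_normal_pdf01 x; have h2 := is_derive_std_normal_cdf x.
  by apply: is_derive_eq; rewrite /GRing.scale/= mulrBl mulNr addrC.
have [tw|/ltW wt] := leP t w.
  have [c [tc cw /= E]] := MVT_global tw dg.
  rewrite -subr_ge0 -[X in _ <= X]/((phi + w \*: Phi) w - (phi + w \*: Phi) t) E.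
  by rewrite !mulr_ge0 ?subr_ge0 ?normal_pdf_ge0.
have [c [wc ct /= E]] := MVT_global wt dg.
rewrite -subr_le0 -[X in X <= _]/((phi + w \*: Phi) t - (phi + w \*: Phi) w) E.
by rewrite !mulr_le0_ge0 ?subr_ge0 ?subr_le0 ?normal_pdf_ge0.
Qed.

(** Letting [t] tend to minus infinity in [pdf_cdf_max] leaves [0 <= phi w + w * Phi w]. The limit
    is taken by contradiction, at one point [a] where [Phi a] is small enough. *)
Lemma mills_left w : w <= 0 -> - w * Phi w <= phi w.
Proof.
rewrite le_eqVlt => /predU1P[->|w0]; first by rewrite oppr0 mul0r normal_pdf_ge0.
rewrite leNgt; apply/negP => lt_e.
have e0 : 0 < (- w * Phi w - phi w) / - w by rewrite divr_gt0 ?subr_gt0 ?oppr_gt0.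
have [a] := filter_ex (cvgr_lt _ std_normal_cdf_cvg.1 _ e0).
rewrite ltr_pdivlMr ?oppr_gt0// => lt_a.
by have := pdf_cdf_max w a; have := normal_pdf_ge0 0 1 a; lra.
Qed.

(** The same argument at plus infinity, where [Phi] tends to 1. *)
Lemma mills_right w : 0 <= w -> w * (1 - Phi w) <= phi w.
Proof.
rewrite le_eqVlt => /predU1P[<-|w0]; first by rewrite mul0r normal_pdf_ge0.
rewrite leNgt; apply/negP => lt_e.
have e0 : 1 - (w * (1 - Phi w) - phi w) / w < 1.
  by rewrite ltrBlDr ltrDl divr_gt0 ?subr_gt0.
have [a] := filter_ex (cvgr_gt _ std_normal_cdf_cvg.2 _ e0).
rewrite ltrBlDr -ltrBlDl ltr_pdivlMr// => lt_a.
by have := pdf_cdf_max w a; have := normal_pdf_ge0 0 1 a; lra.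
Qed.

(** * Bounds on the Stein solution for a weight between 0 and 1 *)

Section solution.
Variable h : R -> R.
Hypotheses (ch : continuous h) (h01 : forall x, 0 <= h x <= 1).

(** The bounded solution of Stein's equation [f' w - w * f w = h w - gauss_mean h], obtained with
    [phi] as integrating factor. *)
Definition stein_solution w := (gauss_cdf h w - gauss_mean h * Phi w) / phi w.

Lemma is_derive_stein_solution w : is_derive w (1 : R) stein_solution
  (w * stein_solution w + (h w - gauss_mean h)).
Proof.
have phi0 x : phi x != 0 by rewrite gt_eqF// normal_pdf01_gt0.
have h1 := is_derive_normal_pdf01 w; have h2 := is_derive_std_normal_cdf w.
have h3 := is_derive_gauss_cdf ch h01 w.
have h4 := is_deriveV (phi0 w) h1.
have -> : stein_solution =
    (gauss_cdf h - gauss_mean h \*: Phi) * (fun y => (phi y)^-1).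
  exact/funext.
apply: is_derive_eq; rewrite /=.
rewrite -[X in w * X]/((gauss_cdf h w - gauss_mean h * Phi w) / phi w).
rewrite -![X in X *: _ + _]/(gauss_cdf h w - gauss_mean h * Phi w).
rewrite /GRing.scale/=.
move: (gauss_cdf h w) (gauss_mean h) (Phi w) (phi w) (phi0 w) => a b c p p0.
by field.
Qed.

Let h1 : continuous (cst 1 : R -> R). Proof. by move=> y; exact: cvg_cst. Qed.

Let gauss_mean01 : 0 <= gauss_mean h <= 1.
Proof.
apply/andP; split.
  exact: le_trans (gauss_cdf_ge0 h01 0) (gauss_mean_ge ch h01 0).
have [t|t|//|] := le_gauss_cdf 0 ch h1; try by case/andP: (h01 t).
by rewrite -std_normal_cdfE gauss_mean1; lra.
Qed.

(** The numerator is a difference of two numbers in [[0, Phi w]]. Written as [gauss_mean h * (1 -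
    Phi w) - (gauss_mean h - gauss_cdf h w)], it is also a difference of two numbers in
    [[0, 1 - Phi w]]. *)
Let numerator_le w :
  `|gauss_cdf h w - gauss_mean h * Phi w| <= Phi w /\
  `|gauss_cdf h w - gauss_mean h * Phi w| <= 1 - Phi w.
Proof.
have [t|t|//|] := le_gauss_cdf w ch h1; try by case/andP: (h01 t).
rewrite -std_normal_cdfE gauss_mean1.
have := gauss_cdf_ge0 h01 w; have := gauss_mean_ge ch h01 w.
have := std_normal_cdf_ge0 w; have := std_normal_cdf_le1 w.
case/andP: gauss_mean01.
move: (gauss_cdf h w) (gauss_mean h) (Phi w) => a b c *.
by rewrite !ler_norml; split; nra.
Qed.

Lemma stein_solution_mul_le w : `|w * stein_solution w| <= 1.
Proof.
have p0 := normal_pdf01_gt0 w.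
rewrite mulrA normrM normfV [X in _ / X]gtr0_norm// ler_pdivrMr// mul1r normrM.
have [n1 n2] := numerator_le w.
have [w0|/ltW w0] := leP w 0.
  apply: le_trans (mills_left w0); rewrite ler0_norm//.
  by rewrite ler_wpM2l// oppr_ge0.
by apply: le_trans (mills_right w0); rewrite ger0_norm// ler_wpM2l.
Qed.

(** Outside [[-1, 1]] the bound on [w * stein_solution w] suffices; inside, the numerator is at most
    1 and the density at least 1/6. *)
Lemma stein_solution_le w : `|stein_solution w| <= 6.
Proof.
have [w1|w1] := leP `|w| 1; last first.
  have := stein_solution_mul_le w; rewrite normrM => le1.
  have := normr_ge0 (stein_solution w).
  by nra.
have p6 := normal_pdf01_ge w1; have p0 := normal_pdf01_gt0 w.
rewrite normrM normfV [X in _ / X]gtr0_norm// ler_pdivrMr//.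
have [n1 _] := numerator_le w; apply: (le_trans n1).
by apply: (le_trans (std_normal_cdf_le1 w)); lra.
Qed.

Lemma stein_solution_derive_le w :
  `|w * stein_solution w + (h w - gauss_mean h)| <= 2.
Proof.
have := stein_solution_mul_le w; have := h01 w; case/andP: gauss_mean01.
by rewrite !ler_norml => ? ? /andP[? ?] /andP[? ?]; apply/andP; split; lra.
Qed.

Lemma stein_solution_lip (a b : R) :
  `|stein_solution b - stein_solution a| <= 2 * `|b - a|.
Proof.
wlog ab : a b / a <= b => [th|].
  by have [/th//|/ltW/th] := leP a b; rewrite distrC [`|a - b|]distrC.
have [c [_ _ ->]] := MVT_global ab is_derive_stein_solution.
by rewrite normrM ler_wpM2r// stein_solution_derive_le.
Qed.

(** By the mean value theorem the error is [v - w] times a variation of the derivative, which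
    Stein's equation splits into three increments. The modulus [k] of [h] is local to [w], since for
    a ramp it vanishes away from the slope. *)
Lemma stein_solution_taylor (delta w v : R) (k : R) : `|v - w| <= delta ->
  (forall x, `|x - w| <= delta -> `|h x - h w| <= k) ->
  `|stein_solution v - stein_solution w -
    (v - w) * (w * stein_solution w + (h w - gauss_mean h))| <=
  delta * (2 * delta * `|w| + 6 * delta + k).
Proof.
move=> vw hk; set f := stein_solution.
have [c [cw fvw]] : exists c, `|c - w| <= delta /\
    f v - f w = (c * f c + (h c - gauss_mean h)) * (v - w).
  have [/[dup] wv|/ltW/[dup] wv] := leP w v.
    move=> /MVT_global /(_ is_derive_stein_solution)[c [wc cv E]]; exists c.
    split=> //; apply: le_trans vw; rewrite !ger0_norm ?subr_ge0//.
    by rewrite lerB.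
  move=> /MVT_global /(_ is_derive_stein_solution)[c [wc cv E]]; exists c.
  split; last by rewrite -opprB E -mulrN opprB.
  apply: le_trans vw; rewrite !ler0_norm ?subr_le0// lerN2.
  by rewrite lerB.
rewrite fvw -/f [X in X - _]mulrC -mulrBr normrM.
apply: ler_pM => //.
have -> : c * f c + (h c - gauss_mean h) - (w * f w + (h w - gauss_mean h)) =
    w * (f c - f w) + (c - w) * f c + (h c - h w) by ring.
apply: (le_trans (ler_normD _ _)); apply: lerD; last exact: hk.
apply: (le_trans (ler_normD _ _)); apply: lerD; rewrite normrM.
  rewrite mulrC ler_wpM2r//; apply: le_trans (stein_solution_lip _ _) _.
  by rewrite ler_wpM2l.
rewrite mulrC; apply: ler_pM => //; exact: stein_solution_le.
Qed.

End solution.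

End stein_equation.

(** * Kolmogorov bound from a Stein coupling *)

Section ramp.
Context {R : realType}.
Local Notation Phi := (@std_normal_cdf R).
Implicit Types (z a w : R).

(** A continuous stand-in for the indicator of [w <= z]; continuity is what makes the Stein solution
    differentiable. *)
Definition ramp z a w : R := Num.min 1 (Num.max 0 ((z + a - w) / a)).

Lemma ramp01 z a w : 0 <= ramp z a w <= 1.
Proof. by rewrite /ramp le_min ler01 le_max lexx/= ge_min lexx. Qed.

Lemma ramp_eq1 z a w : 0 < a -> w <= z -> ramp z a w = 1.
Proof.
move=> a0 wz; rewrite /ramp min_l// le_max; apply/orP; right.
by rewrite ler_pdivlMr//; lra.
Qed.

Lemma ramp_eq0 z a w : 0 < a -> z + a <= w -> ramp z a w = 0.
Proof.
move=> a0 wz; rewrite /ramp max_l ?min_r//.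
by rewrite ler_pdivrMr//; lra.
Qed.

Lemma ramp_lip z a (v w : R) : 0 < a -> `|ramp z a v - ramp z a w| <= `|v - w| / a.
Proof.
move=> a0; have -> : `|v - w| / a = `|(z + a - w) / a - (z + a - v) / a|.
  by rewrite -mulrBl normrM normfV (gtr0_norm a0); congr (`|_| / a); lra.
rewrite /ramp; set s := (z + a - v) / a; set t := (z + a - w) / a.
wlog st : s t / s <= t => [th|].
  by have [/th//|/ltW/th] := leP s t; rewrite distrC [`|t - s|]distrC.
rewrite distrC [leRHS]ger0_norm ?subr_ge0// ger0_norm ?subr_ge0.
  rewrite /Num.min /Num.max.
  by case: (ltP 0 s) => ?; case: (ltP 0 t) => ?;
    do 2 case: ltP => ?; lra.
rewrite /Num.min /Num.max.
by case: (ltP 0 s) => ?; case: (ltP 0 t) => ?; do 2 case: ltP => ?; lra.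
Qed.

Lemma continuous_ramp z a : 0 < a -> continuous (ramp z a).
Proof.
move=> a0 w; apply/cvgrPdist_le => e e0; near=> v.
apply: le_trans (ramp_lip _ _ _ a0) _; rewrite ler_pdivrMr//.
near: v; apply: cvgr_dist_le; first exact: cvg_id.
by rewrite mulr_gt0.
Unshelve. all: by end_near. Qed.

(** Both points lie on the same flat piece unless [w] is in the window. The window is open on the
    left and closed on the right, so that its probability is a difference of two values of a
    distribution function. *)
Lemma ramp_modulus z a delta (v w : R) : 0 < a -> `|v - w| <= delta ->
  `|ramp z a v - ramp z a w| <=
  delta / a * ((z - 2 * delta < w) && (w <= z + a + delta))%:R.
Proof.
move=> a0 vw; have : `|v - w| <= delta by [].
rewrite ler_norml => /andP[vw1 vw2].
have [w1|w1] := ltP (z - 2 * delta) w; last first.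
  by rewrite mulr0 !ramp_eq1 ?subrr ?normr0//; lra.
have [w2|w2] := leP w (z + a + delta); last first.
  by rewrite mulr0 !ramp_eq0 ?subrr ?normr0//; lra.
rewrite mulr1; apply: le_trans (ramp_lip _ _ _ a0) _.
by rewrite ler_wpM2r ?invr_ge0 ?(ltW a0).
Qed.

Lemma gauss_mean_ramp z a : 0 < a -> Phi z <= gauss_mean (ramp z a) <= Phi (z + a).
Proof.
move=> a0; have cr := @continuous_ramp z a a0; have r01 := ramp01 z a.
apply/andP; split.
  apply: le_trans (gauss_mean_ge cr r01 z).
  rewrite std_normal_cdfE le_eqVlt; apply/orP; left; apply/eqP.
  apply: eq_Rintegral => t; rewrite inE/= in_itv/= => tz.
  by rewrite ramp_eq1.
have -> : gauss_mean (ramp z a) = gauss_cdf (ramp z a) (z + a).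
  apply/eqP; rewrite -subr_eq0 /gauss_mean -set_itvNyy Rintegral_itvB//; last first.
    by rewrite set_itvNyy; exact: integrable_gauss.
  rewrite (eq_Rintegral _ (g := cst 0)) ?Rintegral_cst ?mul0r// => t.
  by rewrite inE/= in_itv/= andbT => /ltW tz; rewrite ramp_eq0// mul0r.
have c1 : continuous (cst 1 : R -> R) by move=> y; exact: cvg_cst.
have r0 t : 0 <= ramp z a t by case/andP: (r01 t).
have r1 t : ramp z a t <= cst 1 t by case/andP: (r01 t).
have [+ _] := le_gauss_cdf (z + a) cr c1 r0 r1 (fun=> lexx 1).
by rewrite -std_normal_cdfE.
Qed.

End ramp.

(** * The smoothing argument for a weighted coupling on a finite space *)

Section stein_coupling.
Context {R : realType} {Om E : finType}.
Variables (p W : Om -> R) (b W' : E -> Om -> R) (beta delta : R).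
Local Notation Phi := (@std_normal_cdf R).
Local Notation Ex F := (\sum_x p x * F x).

Hypotheses (p_ge0 : forall x, 0 <= p x) (p_sum : \sum_x p x = 1).
Hypotheses (b_ge0 : forall e x, 0 <= b e x)
  (b_sum : forall x, \sum_e b e x <= beta).
Hypothesis W'_near : forall e x, `|W' e x - W x| <= delta.
Hypothesis coupling : forall f : R -> R,
  Ex (fun x => W x * f (W x)) =
  Ex (fun x => \sum_e b e x * (f (W' e x) - f (W x))).
Hypothesis W_sqr : Ex (fun x => W x ^+ 2) = 1.
Hypothesis delta_gt0 : 0 < delta.

Definition finite_cdf t : R := Ex (fun x => (W x <= t)%R%:R).

(** By [coupling] with the identity and [W_sqr], the inner sum has mean 1, so this is its
    variance. *)
Let V := Ex (fun x => (1 - \sum_e b e x * (W' e x - W x)) ^+ 2).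
Let kappa := beta * delta ^+ 2.

Let le_Ex (F G : Om -> R) : (forall x, F x <= G x) -> Ex F <= Ex G.
Proof. by move=> FG; apply: ler_sum => x _; rewrite ler_wpM2l. Qed.

Let Ex_cst (c : R) : Ex (fun=> c) = c.
Proof. by rewrite -mulr_suml p_sum mul1r. Qed.

Let ExD (F G : Om -> R) : Ex (fun x => F x + G x) = Ex F + Ex G.
Proof. by rewrite -big_split/=; apply: eq_bigr => x _; rewrite mulrDr. Qed.

Let ExZ (c : R) (F : Om -> R) : Ex (fun x => c * F x) = c * Ex F.
Proof. by rewrite mulr_sumr; apply: eq_bigr => x _; rewrite mulrCA. Qed.

Let ExB (F G : Om -> R) : Ex (fun x => F x - G x) = Ex F - Ex G.
Proof.
rewrite -[- Ex G]mulN1r -ExZ -ExD.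
by apply: eq_bigr => x _; rewrite mulN1r.
Qed.

Let Ex_norm (F : Om -> R) : `|Ex F| <= Ex (fun x => `|F x|).
Proof.
apply: le_trans (ler_norm_sum _ _ _) _; apply: ler_sum => x _.
by rewrite normrM ger0_norm.
Qed.

(** This is the nonnegativity of the variance of [|F|]. *)
Let Ex_norm_sqrt (F : Om -> R) :
  Ex (fun x => `|F x|) <= Num.sqrt (Ex (fun x => F x ^+ 2)).
Proof.
set m := Ex _; have m0 : 0 <= m by apply: sumr_ge0 => x _; rewrite mulr_ge0.
rewrite -(ger0_norm m0) -sqrtr_sqr ler_sqrt; last first.
  by apply: sumr_ge0 => x _; rewrite mulr_ge0// sqr_ge0.
have : 0 <= Ex (fun x => (`|F x| - m) ^+ 2).
  by apply: sumr_ge0 => x _; rewrite mulr_ge0// sqr_ge0.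
have -> : Ex (fun x => (`|F x| - m) ^+ 2) =
    Ex (fun x => (F x ^+ 2 - (2 * m) * `|F x|) + m ^+ 2).
  apply: eq_bigr => x _; congr (_ * _).
  by rewrite sqrrB real_normK ?num_real// -mulr_natl; ring.
by rewrite ExD ExB ExZ Ex_cst -/m; nra.
Qed.

(** Take the identity in [coupling]: the unit second moment of [W] is at most the total weight times
    the step. Hence [delta <= kappa], and stray terms in [delta] can be absorbed. *)
Let beta_delta_ge1 : 1 <= beta * delta.
Proof.
rewrite -W_sqr (eq_bigr (fun x => p x * (W x * id (W x)))); last first.
  by move=> x _; rewrite expr2.
rewrite (coupling id) -[leRHS]Ex_cst; apply: le_Ex => x.
apply: (@le_trans _ _ (\sum_e b e x * delta)).
  by apply: ler_sum => e _; rewrite ler_wpM2l// (le_trans (ler_norm _)).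
by rewrite -mulr_suml ler_wpM2r// ltW.
Qed.

Let kappa_ge : delta <= kappa.
Proof. by rewrite /kappa expr2 mulrA ler_peMl// ltW. Qed.

(** Stein's equation and [coupling] write the left side as the mean of [f' (W x) * g x] minus a
    weighted Taylor remainder [r]. The first part costs [2 * Num.sqrt V] since [f'] is at most 2; in
    the second, 8 is 6 plus 2 times the mean of [|W|], which is at most 1. *)
Let smoothed_bound z a : 0 < a ->
  `|Ex (fun x => ramp z a (W x)) - gauss_mean (ramp z a)| <=
  2 * Num.sqrt V + kappa * (8 + a^-1 *
    Ex (fun x => ((z - 2 * delta < W x) && (W x <= z + a + delta))%:R)).
Proof.
move=> a0; set h := ramp z a; set c := gauss_mean h; set f := stein_solution h.
set I := fun x => ((z - 2 * delta < W x) && (W x <= z + a + delta))%:R : R.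
pose f' w := w * f w + (h w - c).
pose g x := 1 - \sum_e b e x * (W' e x - W x).
pose r x := \sum_e b e x * (f (W' e x) - f (W x) - (W' e x - W x) * f' (W x)).
have ch : continuous h by exact: continuous_ramp.
have h01 : forall x, 0 <= h x <= 1 by exact: ramp01.
have -> : Ex (fun x => h (W x)) - c = Ex (fun x => f' (W x) * g x - r x).
  rewrite -[X in _ - X]Ex_cst -ExB.
  transitivity (Ex (fun x => f' (W x) - W x * f (W x))).
    by apply: eq_bigr => x _; congr (_ * _); rewrite /f'; ring.
  rewrite ExB coupling -ExB; apply: eq_bigr => x _; congr (_ * _).
  have -> : r x = \sum_e b e x * (f (W' e x) - f (W x)) -
      f' (W x) * \sum_e b e x * (W' e x - W x).
    by rewrite mulr_sumr -sumrB; apply: eq_bigr => e _; ring.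
  by rewrite /g mulrBr mulr1 opprB addrA subrK.
apply: (le_trans (Ex_norm _)).
pose U x := 2 * `|g x| + beta * (delta * (2 * delta * `|W x| + 6 * delta +
  delta / a * I x)).
apply: (@le_trans _ _ (Ex U)).
  apply: le_Ex => x; apply: (le_trans (ler_normB _ _)); apply: lerD.
    by rewrite normrM ler_wpM2r// stein_solution_derive_le.
  apply: (le_trans (ler_norm_sum _ _ _)).
  set q := delta * _.
  have q0 : 0 <= q.
    by rewrite mulr_ge0 ?addr_ge0 ?mulr_ge0 ?invr_ge0 ?(ltW delta_gt0) ?(ltW a0).
  apply: (@le_trans _ _ (\sum_e b e x * q)); last first.
    by rewrite -mulr_suml ler_wpM2r.
  apply: ler_sum => e _; rewrite normrM ger0_norm// ler_wpM2l//.
  apply: stein_solution_taylor => // v vw; exact: ramp_modulus.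
have -> : Ex U = 2 * Ex (fun x => `|g x|) +
    (2 * kappa * Ex (fun x => `|W x|) + (6 * kappa + kappa / a * Ex I)).
  rewrite -!ExZ -[6 * kappa]Ex_cst -!ExD; apply: eq_bigr => x _; congr (_ * _).
  by rewrite /U /kappa; field; rewrite gt_eqF.
have k0 : 0 <= kappa := le_trans (ltW delta_gt0) kappa_ge.
have := Ex_norm_sqrt W; rewrite W_sqr sqrtr1 => /(ler_wpM2l k0).
have := Ex_norm_sqrt g; rewrite -/V.
move: (Num.sqrt V) (Ex (fun x => `|g x|)) (Ex (fun x => `|W x|)) (Ex I) => s eg eW eI.
by rewrite mulrDr; move: kappa a^-1 => K A; lra.
Qed.

Lemma finite_cdf_discrepancy D : (forall t, `|finite_cdf t - Phi t| <= D) ->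
  forall t, `|finite_cdf t - Phi t| <= D / 2 + (14 * kappa + 2 * Num.sqrt V).
Proof.
move=> Dle t; have k0 := lt_le_trans delta_gt0 kappa_ge.
(* With this width the window probability is multiplied by [kappa / a], that is 1/4, so its part
   [2 * D] contributes [D / 2]. The rest, [(a + 3 * delta) / 4], is at most [7 / 4 * kappa] and,
   added to [8 * kappa], stays below [10 * kappa]. *)
pose a := 4 * kappa; have a0 : 0 < a by rewrite /a; lra.
have interval z :
  Ex (fun x => ((z - 2 * delta < W x) && (W x <= z + a + delta))%:R) <=
  2 * D + a + 3 * delta.
  have -> : Ex (fun x => ((z - 2 * delta < W x) && (W x <= z + a + delta))%:R) =
      finite_cdf (z + a + delta) - finite_cdf (z - 2 * delta).
    rewrite -ExB; apply: eq_bigr => x _; congr (_ * _).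
    case: (leP (W x) (z - 2 * delta)) => w1 /=; last first.
      by rewrite subr0.
    by rewrite (_ : W x <= z + a + delta) ?subrr//; have := delta_gt0; lra.
  have := Dle (z + a + delta); have := Dle (z - 2 * delta).
  have le_z : z - 2 * delta <= z + a + delta by have := delta_gt0; lra.
  have /andP[_] := std_normal_cdf_lip le_z.
  by rewrite !ler_norml => ? /andP[? ?] /andP[? ?]; lra.
have bound z : `|Ex (fun x => ramp z a (W x)) - gauss_mean (ramp z a)| <=
    D / 2 + (10 * kappa + 2 * Num.sqrt V).
  apply: (le_trans (smoothed_bound _ a0)).
  rewrite mulrDr mulrA.
  have -> : kappa / a = 4^-1 by rewrite /a; field; rewrite gt_eqF.
  by have := interval z; have := kappa_ge; rewrite /a; lra.
(* The indicator of [W x <= t] lies between the ramps starting at [t - a] and at [t]; replacing the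
   normal mean of either ramp by [Phi t] costs another [a], hence 14 in place of 10. *)
rewrite ler_norml; apply/andP; split.
- have := bound (t - a); rewrite ler_norml => /andP[b1 b2].
  have /andP[m1 m2] := gauss_mean_ramp (t - a) a0.
  have ta : t - a <= t by lra.
  have /andP[l1 l2] := std_normal_cdf_lip ta.
  have : Ex (fun x => ramp (t - a) a (W x)) <= finite_cdf t.
    apply: le_Ex => x; case: (leP (W x) t) => wt; first by case/andP: (ramp01 (t - a) a (W x)).
    by rewrite ramp_eq0//; lra.
  by rewrite /a in l2; lra.
- have := bound t; rewrite ler_norml => /andP[b1 b2].
  have /andP[m1 m2] := gauss_mean_ramp t a0.
  have ta : t <= t + a by lra.
  have /andP[l1 l2] := std_normal_cdf_lip ta.
  have : finite_cdf t <= Ex (fun x => ramp t a (W x)).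
    apply: le_Ex => x; case: (leP (W x) t) => wt; last by case/andP: (ramp01 t a (W x)).
    by rewrite ramp_eq1.
  by rewrite /a in l2; lra.
Qed.

End stein_coupling.

(** * Moving one ball *)

Section resampling.
Context {R : realFieldType} {n : nat} {V : finType}.
Implicit Types (x : {ffun 'I_n -> V}) (i j k : 'I_n) (v : V).
Local Notation config := {ffun 'I_n -> V}.

Definition move x j v : config := [ffun k => if k == j then v else x k].

Lemma move_at x j v : move x j v j = v.
Proof. by rewrite ffunE eqxx. Qed.

Lemma move_other x j v k : k != j -> move x j v k = x k.
Proof. by rewrite ffunE => /negPf ->. Qed.

Lemma move_move x j v w : move (move x j v) j w = move x j w.
Proof. by apply/ffunP => k; rewrite !ffunE; case: (k == j). Qed.

Lemma move_id x j : move x j (x j) = x.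
Proof. by apply/ffunP => k; rewrite !ffunE; case: eqP => // ->. Qed.

Lemma moveC x j k v w : j != k -> move (move x j v) k w = move (move x k w) j v.
Proof.
move=> jk; apply/ffunP => l; rewrite !ffunE.
by case: (eqVneq l k) => // ->; rewrite eq_sym (negPf jk).
Qed.

(** Exchanging the position of ball [j] with a spare urn [v] is an involution on pairs of a
    configuration and an urn. *)
Lemma sum_move (H : config -> R) j :
  \sum_x \sum_v H (move x j v) = #|V|%:R * \sum_x H x.
Proof.
rewrite pair_big/=.
have inv : involutive (fun p : config * V => (move p.1 j p.2, p.1 j)).
  by case=> x v /=; rewrite move_move move_id move_at.
rewrite (reindex_inj (inv_inj inv))/=.
under eq_bigr => p _ do rewrite move_move move_id.
rewrite -(pair_big xpredT xpredT (fun x _ => H x))/= mulr_sumr.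
by apply: eq_bigr => x _; rewrite sumr_const mulr_natl.
Qed.

(* Ball [j] joins the urn of ball [i] with probability [1 / #|V|], independently
   of the other balls. *)
Lemma sum_same_urn (G : config -> R) i j : i != j ->
  \sum_(x : config) G (move x j (x i)) = #|V|%:R * \sum_(x : config | x j == x i) G x.
Proof.
move=> ij; rewrite [in RHS]big_mkcond -(sum_move _ j); apply: eq_bigr => x _.
rewrite (bigD1 (x i))//= move_at move_other// eqxx big1 ?addr0// => v vi.
by rewrite move_at move_other// (negPf vi).
Qed.

End resampling.

(** * The Efron-Stein inequality *)

Section efron_stein.
Context {R : realFieldType} {n : nat} {V : finType}.
Local Notation config := {ffun 'I_n -> V}.
Local Notation m := (#|V|%:R : R).
Implicit Types (F G : config -> R) (k l : 'I_n) (x y : config) (s : seq 'I_n).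
Hypothesis V_gt0 : (0 < #|V|)%N.

Let m_neq0 : m != 0. Proof. by rewrite pnatr_eq0 -lt0n. Qed.

Lemma sqr_mean_le (a : V -> R) :
  (m^-1 * \sum_v a v) ^+ 2 <= m^-1 * \sum_v a v ^+ 2.
Proof.
set c := m^-1 * _.
have : 0 <= m^-1 * \sum_v (a v - c) ^+ 2.
  by rewrite mulr_ge0 ?invr_ge0// sumr_ge0// => v _; rewrite sqr_ge0.
have -> : \sum_v (a v - c) ^+ 2 = \sum_v a v ^+ 2 - m * c ^+ 2.
  under eq_bigr => v _ do rewrite sqrrB.
  rewrite big_split sumrB/= sumr_const sumrMnl -mulr_suml -(mulr_natl _ #|V|).
  have -> : \sum_v a v = m * c by rewrite /c mulrA mulfV// mul1r.
  by rewrite mulr2n; ring.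
by rewrite mulrBr mulrA mulVf// mul1r subr_ge0.
Qed.

(** The conditional expectation of [F] given the positions of all balls other than [k]. *)
Definition average k F x : R := m^-1 * \sum_v F (move x k v).

Lemma sum_average k F : \sum_x average k F x = \sum_x F x.
Proof. by rewrite -mulr_sumr sum_move mulrA mulVf// mul1r. Qed.

Lemma average_move k F x v : average k F (move x k v) = average k F x.
Proof. by congr (_ * _); apply: eq_bigr => w _; rewrite move_move. Qed.

Lemma averageC k l F x : average k (average l F) x = average l (average k F) x.
Proof.
have [->//|kl] := eqVneq k l.
rewrite /average; under eq_bigr do rewrite mulr_sumr.
under [in RHS]eq_bigr do rewrite mulr_sumr.
rewrite exchange_big/=; congr (_ * _); apply: eq_bigr => v _.
by apply: eq_bigr => w _; rewrite moveC.
Qed.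

Lemma averageB k F G x :
  average k (fun y => F y - G y) x = average k F x - average k G x.
Proof. by rewrite /average sumrB mulrBr. Qed.

Lemma eq_average k F G : F =1 G -> average k F =1 average k G.
Proof. by move=> FG x; congr (_ * _); apply: eq_bigr => v _; rewrite FG. Qed.

(** Averaging is an orthogonal projection: the cross term reduces to the squared norm of the
    average, which does not depend on ball [k]. *)
Lemma average_pythagoras k F :
  \sum_x (F x - average k F x) ^+ 2 =
  \sum_x F x ^+ 2 - \sum_x average k F x ^+ 2.
Proof.
have cross : \sum_x F x * average k F x = \sum_x average k F x ^+ 2.
  rewrite -(sum_average k); apply: eq_bigr => x _.
  rewrite /average; under eq_bigr do rewrite -/(average k F _) average_move.
  by rewrite -mulr_suml mulrA expr2.
under eq_bigr => x _ do rewrite sqrrB.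
rewrite big_split sumrB/= sumrMnl cross.
by rewrite mulr2n; ring.
Qed.

Definition averages s F := foldr average F s.

Lemma average_averages k s F x :
  average k (averages s F) x = averages s (average k F) x.
Proof.
elim: s x => //= l s IH x; rewrite averageC.
exact: eq_average.
Qed.

Lemma averagesB s F G x :
  averages s (fun y => F y - G y) x = averages s F x - averages s G x.
Proof.
elim: s x => //= l s IH x; rewrite -averageB.
exact: eq_average.
Qed.

Lemma averages_contraction s F :
  \sum_x averages s F x ^+ 2 <= \sum_x F x ^+ 2.
Proof.
elim: s => //= l s IH; apply: le_trans IH; rewrite -subr_ge0.
by rewrite -average_pythagoras sumr_ge0// => x _; rewrite sqr_ge0.
Qed.

(** The loss of squared norm telescopes along [s]. By commutation, the loss at [k] is the squared
    norm of [averages s] applied to [F - average k F], and [averages s] is a contraction. *)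
Lemma averages_defect s F :
  \sum_x F x ^+ 2 - \sum_x averages s F x ^+ 2 <=
  \sum_(k <- s) \sum_x (F x - average k F x) ^+ 2.
Proof.
elim: s => [|k s IH]; first by rewrite big_nil subrr.
rewrite big_cons/= -[leLHS](subrKA (\sum_x averages s F x ^+ 2)) addrC.
apply: lerD => //; rewrite -average_pythagoras.
apply: le_trans (averages_contraction s _); apply: ler_sum => x _.
by rewrite averagesB average_averages.
Qed.

Lemma averages_move k s F x v : k \in s ->
  averages s F (move x k v) = averages s F x.
Proof.
elim: s x => //= l s IH x; rewrite inE.
have [-> _|kl /= ks] := eqVneq k l; first exact: average_move.
by congr (_ * _); apply: eq_bigr => w _; rewrite moveC// IH.
Qed.

Lemma move_invariant_const F : (forall x k v, F (move x k v) = F x) ->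
  forall x y, F x = F y.
Proof.
move=> Finv x y.
(* Hybrid configurations lead from [x] to [y], changing one ball at a time. *)
pose z r : config := [ffun k : 'I_n => if (k < r)%N then y k else x k].
have zP r : (r <= n)%N -> F (z r) = F x.
  elim: r => [_|r IH rn].
    by congr F; apply/ffunP => k; rewrite ffunE.
  rewrite -IH ?(ltnW rn)// -(Finv (z r) (Ordinal rn) (y (Ordinal rn))).
  congr F; apply/ffunP => k; rewrite !ffunE ltnS leq_eqVlt -val_eqE/=.
  by case: eqP => //= kr; congr (y _); apply: val_inj.
rewrite -(zP n)//; congr F; apply/ffunP => k.
by rewrite ffunE ltn_ord.
Qed.

(** Averaging over every ball turns [F] into the constant [c], so the variance is the total defect.
    Jensen's inequality then bounds each [F - average k F] by resampled differences, which gives the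
    constant 1 instead of the sharp 1/2. *)
Theorem efron_stein F c : \sum_x F x = #|{: config}|%:R * c ->
  \sum_x (F x - c) ^+ 2 <=
  \sum_k m^-1 * \sum_x \sum_v (F x - F (move x k v)) ^+ 2.
Proof.
move=> Fc.
have avg x : averages (enum 'I_n) F x = c.
  have cst := move_invariant_const (fun x k v =>
    averages_move F x v (mem_enum 'I_n k)).
  have N0 : #|{: config}|%:R != 0 :> R.
    by rewrite pnatr_eq0 -lt0n; apply/card_gt0P; exists x.
  apply: (mulfI N0); rewrite -Fc.
  transitivity (\sum_y averages (enum 'I_n) F y).
    rewrite (eq_bigr (fun=> averages (enum 'I_n) F x)) => [|y _]; last exact: cst.
    by rewrite sumr_const mulr_natl.
  by elim: (enum 'I_n) => //= k s <-; rewrite sum_average.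
have -> : \sum_x (F x - c) ^+ 2 =
    \sum_x F x ^+ 2 - \sum_x averages (enum 'I_n) F x ^+ 2.
  under eq_bigr => x _ do rewrite sqrrB.
  under [X in _ = _ - X]eq_bigr => x _ do rewrite avg.
  rewrite big_split sumrB/= sumrMnl -mulr_suml Fc sumr_const.
  by rewrite -(mulr_natl _ #|_|) mulr2n; ring.
apply: (le_trans (averages_defect _ _)); rewrite big_enum/=.
apply: ler_sum => k _; rewrite mulr_sumr; apply: ler_sum => x _.
have -> : F x - average k F x = m^-1 * \sum_v (F x - F (move x k v)).
  rewrite sumrB mulrBr sumr_const -[F x *+ _]mulr_natl mulrA mulVf//.
  by rewrite mul1r.
exact: sqr_mean_le.
Qed.

End efron_stein.

(** * Occupancy numbers *)

Section occupancy.
Context {R : realFieldType} {n : nat} {V : finType}.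
Local Notation config := {ffun 'I_n -> V}.
Implicit Types (x : config) (i j k : 'I_n) (v w : V).

Definition occ x v := (\sum_k (x k == v))%N.

Definition crowded x i : R := (1 < occ x (x i))%N%:R.

Definition crowd x : R := \sum_i crowded x i.

(** The additive form avoids truncated subtraction and covers [x k = v] as well. *)
Lemma occ_move x k v w :
  (occ (move x k v) w + (x k == w) = occ x w + (v == w))%N.
Proof.
rewrite /occ (bigD1 k)//= [in RHS](bigD1 k)//= move_at.
rewrite (eq_bigr (fun i => (x i == w : nat))) => [|i ik]; last by rewrite move_other.
by rewrite -addnA addnC [X in (X + _)%N]addnC.
Qed.

Lemma occ_move_far x k v w : x k != w -> v != w -> occ (move x k v) w = occ x w.
Proof. by move=> /negPf xw /negPf vw; have := occ_move x k v w; rewrite xw vw !addn0. Qed.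

Let urn_crowd (N : nat) : R := if (1 < N)%N then N%:R else 0.

Lemma crowdE x : crowd x = \sum_v urn_crowd (occ x v).
Proof.
rewrite /crowd (partition_big x xpredT)//=; apply: eq_bigr => v _.
rewrite (eq_bigr (fun=> (1 < occ x v)%N%:R)); last first.
  by move=> i /eqP <-.
rewrite sumr_const /urn_crowd.
have -> : #|[pred i | x i == v]| = occ x v.
  by rewrite /occ -sum1_card big_mkcond/=; apply: eq_bigr => i _; rewrite inE; case: eqP.
by case: ifP => _ //; rewrite mul0rn.
Qed.

(** The gain in non-isolated balls when an urn passes from [N] to [N.+1] balls: the first ball is
    isolated, the second makes both non-isolated, later ones add themselves. *)
Definition crowd_step (N : nat) : R := if N is 0 then 0 else if N is 1 then 2 else 1.

Let urn_crowdS N : urn_crowd N.+1 = urn_crowd N + crowd_step N.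
Proof.
by case: N => [|[|N]]; rewrite /urn_crowd/= ?add0r// -natr1.
Qed.

Lemma crowd_step_bound N : 0 <= crowd_step N <= 2.
Proof. by case: N => [|[|N]] /=; rewrite ?lexx ?ler01 ?ler0n ?ler1n. Qed.

Lemma crowd_move x j v : crowd (move x j v) - crowd x =
  if x j == v then 0 else crowd_step (occ x v) - crowd_step (occ x (x j)).-1.
Proof.
have [<-|jv] := eqVneq; first by rewrite move_id subrr.
rewrite !crowdE (bigD1 v)//= (bigD1 (x j))//= [X in _ - X](bigD1 v)//=.
rewrite [X in _ - (_ + X)](bigD1 (x j))//=.
rewrite [X in _ + (_ + X) - _](eq_bigr (fun w => urn_crowd (occ x w))); last first.
  by move=> w /andP[wv wj]; rewrite occ_move_far// eq_sym.
have := occ_move x j v v; rewrite eqxx (negPf jv) addn0 addn1 => ->.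
have := occ_move x j v (x j); rewrite eqxx [v == _]eq_sym (negPf jv) addn0 addn1.
move=> E; rewrite -E/= !urn_crowdS; ring.
Qed.

Lemma crowd_move_le x j v : `|crowd (move x j v) - crowd x| <= 2.
Proof.
rewrite crowd_move; case: ifP => _; first by rewrite normr0.
have /andP[? ?] := crowd_step_bound (occ x v).
have /andP[? ?] := crowd_step_bound (occ x (x j)).-1.
by rewrite ler_norml; apply/andP; split; lra.
Qed.

(** The effect of moving [j] to the urn of [i] depends only on the occupancies of their two urns,
    which ball [k] neither leaves nor enters. *)
Lemma crowd_move_local x j i k v : k != i -> k != j ->
  x i \notin [:: x k; v] -> x j \notin [:: x k; v] ->
  crowd (move (move x k v) j (move x k v i)) - crowd (move x k v) =
  crowd (move x j (x i)) - crowd x.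
Proof.
rewrite !inE !negb_or => ki kj /andP[ik iv] /andP[jk jv].
rewrite !crowd_move !move_other 1?eq_sym//.
by rewrite !occ_move_far// eq_sym.
Qed.

End occupancy.

(** * The coupling of non-isolated balls *)

(** The summands are successive differences of [q ^+ (n - j) * \prod_(k < j) u k]. *)
Lemma telescope_geometric_nat (R : comPzRingType) (q : R) (u : nat -> R) n :
  \sum_(j < n) q ^+ (n.-1 - j) * (\prod_(k < j) u k) * (u j - q) =
  \prod_(k < n) u k - q ^+ n.
Proof.
elim: n => [|n IH]; first by rewrite !big_ord0 expr0 subrr.
rewrite big_ord_recr/= subnn expr0 mul1r [in RHS]big_ord_recr/= exprS.
rewrite (eq_bigr (fun j : 'I_n =>
  q * (q ^+ (n.-1 - j) * (\prod_(k < j) u k) * (u j - q)))); last first.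
  by case: n {IH} => [[]//|n] j _; rewrite /= subSn ?exprS ?mulrA// -ltnS.
by rewrite -mulr_sumr IH; ring.
Qed.

Lemma telescope_geometric (R : comPzRingType) (q : R) n (u : 'I_n -> R) :
  \sum_(j < n) q ^+ (n.-1 - j) * (\prod_(k < n | (k < j)%N) u k) * (u j - q) =
  \prod_k u k - q ^+ n.
Proof.
pose w k := if insub k is Some i then u i else 0.
have wE i : w (val i) = u i by rewrite /w valK.
have := telescope_geometric_nat q w n; under [in X in _ = X]eq_bigr do rewrite wE.
move=> <-; apply: eq_bigr => j _; rewrite wE; congr (_ * _ * _).
rewrite (big_ord_widen n w) 1?ltnW//.
by apply: eq_bigr => i _; rewrite wE.
Qed.

Section urn_coupling.
Context {R : realFieldType} {n : nat} {V : finType}.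
Local Notation config := {ffun 'I_n -> V}.
Local Notation m := (#|V|%:R : R).
Implicit Types (x : config) (i j k : 'I_n) (v w : V).
Hypotheses (n_gt0 : (0 < n)%N) (V_gt1 : (1 < #|V|)%N).

Definition miss_prob : R := 1 - m^-1.
Local Notation q := miss_prob.

Definition crowded_prob : R := 1 - q ^+ n.-1.

Let m_gt0 : 0 < m. Proof. by rewrite ltr0n ltnW. Qed.

Let m_neq0 : m != 0. Proof. by rewrite gt_eqF. Qed.

Lemma miss_prob_gt0 : 0 < q.
Proof. by rewrite subr_gt0 invf_lt1// ltr1n. Qed.

Lemma miss_prob_le1 : q <= 1.
Proof. by rewrite lerBlDr lerDl invr_ge0 ltW. Qed.

Let q_neq0 : q != 0. Proof. by rewrite gt_eqF// miss_prob_gt0. Qed.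

Let q_ge0 : 0 <= q. Proof. exact: ltW miss_prob_gt0. Qed.

Let exprSq : q ^+ n = q * q ^+ n.-1.
Proof. by rewrite -exprS prednK. Qed.

(* The value [q] at [k = i] lets the telescoping run over all balls: the term
   [k = i] vanishes and the product over all [k] is [q] times the indicator that
   ball [i] is isolated. *)
Definition miss i k x : R := if k == i then q else (x k != x i)%:R.

Definition weight i j x : R := if i == j then 0 else
  (m * q)^-1 * (q ^+ (n.-1 - j) * \prod_(k < n | (k < j)%N) miss i k x).

(** A deterministic majorant of [weight]: the indicators become 1, while the factor [q] of ball [i]
    is kept, so that the rows still telescope to an exact sum. *)
Definition weight_max i j : R := if i == j then 0 else
  (m * q)^-1 *
  (q ^+ (n.-1 - j) * \prod_(k < n | (k < j)%N) (if k == i then q else 1)).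

Lemma miss_ge0 i k x : 0 <= miss i k x.
Proof. by rewrite /miss; case: ifP. Qed.

Lemma weight_ge0 i j x : 0 <= weight i j x.
Proof.
rewrite /weight; case: ifP => // _.
rewrite mulr_ge0 ?invr_ge0 ?mulr_ge0 ?exprn_ge0 ?(ltW m_gt0)//.
by apply: prodr_ge0 => k _; exact: miss_ge0.
Qed.

Lemma weight_le i j x : weight i j x <= weight_max i j.
Proof.
rewrite /weight /weight_max; case: ifP => // _.
rewrite ler_wpM2l ?invr_ge0 ?mulr_ge0 ?(ltW m_gt0)// ler_wpM2l ?exprn_ge0//.
apply: ler_prod => k _; rewrite miss_ge0/= /miss; case: ifP => // _.
by case: (_ != _).
Qed.

Lemma sum_weight_max i : \sum_j weight_max i j = crowded_prob.
Proof.
pose c k : R := if k == i then q else 1.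
have -> : \sum_j weight_max i j = q^-1 * (\prod_k c k - q ^+ n).
  rewrite -telescope_geometric mulr_sumr; apply: eq_bigr => j _.
  rewrite /weight_max /c eq_sym; case: eqP => [_|_]; first by rewrite subrr !mulr0.
  by rewrite /q opprB addrCA subrr addr0 invfM; ring.
rewrite (bigD1 i)//= big1 => [|k /negPf ki]; last by rewrite /c ki.
rewrite /c eqxx mulr1 exprSq mulrBr mulVf// mulrA mulVf// mul1r.
by [].
Qed.

Lemma prod_miss i x : \prod_k miss i k x = q * (1 - crowded x i).
Proof.
rewrite (bigD1 i)//= /miss eqxx; congr (_ * _).
rewrite /crowded /occ [in RHS](bigD1 i)//= eqxx /= add1n ltnS.
rewrite (eq_bigr (fun k => (x k != x i)%:R)) => [|k /negPf ->//].
have [k /andP[ki /eqP xk]|none] := pickP [pred k | (k != i) && (x k == x i)].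
  rewrite (bigD1 k)//= xk eqxx mul0r [in RHS](bigD1 k)//= xk eqxx /=.
  by rewrite subrr.
rewrite big1 => [|k ki]; last by have /= := none k; rewrite ki => /= ->.
rewrite big1 => [|k ki]; last by have /= := none k; rewrite ki => /= ->.
by rewrite subr0.
Qed.

(** Telescoping [prod_miss] gives terms in [miss i j x - q], which for [j] other than [i] is [m^-1]
    minus the indicator that [j] shares the urn of [i]. Summation turns this indicator into a move
    of [j]. *)
Lemma crowded_coupling i (F : config -> R) :
  \sum_x (crowded x i - crowded_prob) * F x =
  \sum_x \sum_j weight i j x * (F (move x j (x i)) - F x).
Proof.
pose a j x := q ^+ (n.-1 - j) * \prod_(k < n | (k < j)%N) miss i k x.
have -> : \sum_x (crowded x i - crowded_prob) * F x =
    \sum_x \sum_j - q^-1 * (a j x * (miss i j x - q)) * F x.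
  apply: eq_bigr => x _; rewrite -mulr_suml -mulr_sumr; congr (_ * _).
  rewrite telescope_geometric prod_miss exprSq -mulrBr mulNr mulrA mulVf// mul1r.
  by rewrite /crowded_prob; ring.
rewrite exchange_big [RHS]exchange_big/=; apply: eq_bigr => j _.
have [->|ij] := eqVneq j i.
  by rewrite !big1// => x _; rewrite /weight /miss eqxx ?subrr ?mulr0 mul0r.
(* The coefficient [a j] involves only balls before [j] and ball [i], so moving [j] leaves it
   unchanged. *)
have swap : \sum_x a j x * (x j == x i)%:R * F x =
    m^-1 * \sum_x a j x * F (move x j (x i)).
  transitivity (\sum_(x : config | x j == x i) a j x * F x).
    rewrite [RHS]big_mkcond/=; apply: eq_bigr => x _.
    by case: eqP => _; rewrite ?mulr1// mulr0 mul0r.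
  apply: (mulfI m_neq0); rewrite -sum_same_urn 1?eq_sym// mulrA mulfV// mul1r.
  apply: eq_bigr => x _; congr (_ * _ * _); apply: eq_bigr => k kj.
  rewrite /miss !move_other//; first by rewrite eq_sym.
  by apply: contraTneq kj => ->; rewrite ltnn.
transitivity (- q^-1 * \sum_x (m^-1 * (a j x * F x) - a j x * (x j == x i)%:R * F x)).
  rewrite mulr_sumr; apply: eq_bigr => x _; rewrite /miss (negPf ij) /q.
  by case: eqP => _ /=; ring.
rewrite sumrB swap -mulr_sumr -mulrBr -sumrB mulrA mulr_sumr.
apply: eq_bigr => x _; rewrite /weight eq_sym (negPf ij) -/(a j x) invfM.
by ring.
Qed.

End urn_coupling.

(** * Variance of the drift *)

Section urn_load.
Context {R : realFieldType} {n : nat} {V : finType}.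
Local Notation config := {ffun 'I_n -> V}.
Local Notation m := (#|V|%:R : R).
Local Notation N := (#|{: config}|%:R : R).
Implicit Types (x : config) (i j k l : 'I_n) (v w : V).
Hypothesis V_gt0 : (0 < #|V|)%N.

Let m_gt0 : 0 < m. Proof. by rewrite ltr0n. Qed.
Let m_neq0 : m != 0. Proof. by rewrite gt_eqF. Qed.

Lemma prob_same_urn l k : \sum_(x : config) (x l == x k)%:R =
  N * (if l == k then 1 else m^-1).
Proof.
have [->|lk] := eqVneq l k.
  under eq_bigr do rewrite eqxx.
  by rewrite sumr_const mulr1.
rewrite mulrC; apply: (mulfI m_neq0); rewrite mulrA mulfV// mul1r.
have := @sum_same_urn R n V (fun=> 1) k l; rewrite eq_sym => /(_ lk).
rewrite sumr_const => ->; congr (_ * _); rewrite [RHS]big_mkcond/=.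
by apply: eq_bigr => x _; case: eqP.
Qed.

(** There is one term for each pattern of coincidences among the three indices; the patterns overlap
    on the right, hence an inequality. *)
Lemma prob_same_urn3 l i k :
  \sum_(x : config) (x l == x k)%:R * (x i == x k)%:R <=
  N * ((l == k)%:R * (i == k)%:R +
    m^-1 * ((l == k)%:R + (i == k)%:R + (l == i)%:R) + m^-1 ^+ 2).
Proof.
have mi0 : 0 <= m^-1 by rewrite invr_ge0 ltW.
have mm0 : 0 <= m^-1 ^+ 2 by rewrite exprn_ge0.
have [->|lk] := eqVneq l k.
  under eq_bigr do rewrite eqxx mul1r.
  rewrite prob_same_urn ler_wpM2l// [k == i]eq_sym.
  by case: eqP => _ /=; lra.
have [->|ik] := eqVneq i k.
  under eq_bigr do rewrite eqxx mulr1.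
  rewrite prob_same_urn ler_wpM2l// (negPf lk).
  by rewrite /=; lra.
have [->|li] := eqVneq l i.
  under eq_bigr do rewrite -natrM mulnb andbb.
  rewrite prob_same_urn ler_wpM2l// (negPf ik).
  by rewrite /=; lra.
rewrite mul0r !add0r mulr0 add0r expr2 mulrA le_eqVlt; apply/orP; left; apply/eqP.
transitivity (\sum_(x : config | x l == x k) (x i == x k)%:R : R).
  rewrite [RHS]big_mkcond/=; apply: eq_bigr => x _.
  by case: (x l == x k); rewrite ?mul1r ?mul0r.
rewrite [RHS]mulrC; apply: (mulfI m_neq0).
rewrite mulrA mulfV// mul1r -sum_same_urn 1?eq_sym//.
under eq_bigr => x _.
  rewrite (move_other x (x k) (_ : i != l)); last by rewrite eq_sym.
  by rewrite (move_other x (x k) (_ : k != l)); [over|rewrite eq_sym].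
by rewrite prob_same_urn (negPf ik).
Qed.

Variable c : 'I_n -> R.
Hypothesis c_ge0 : forall l, 0 <= c l.

Let C1 : R := \sum_l c l.
Let C2 : R := \sum_l c l ^+ 2.

Definition load w x : R := \sum_l c l * (x l == w)%:R.

Let load_sqr w x : load w x ^+ 2 =
  \sum_l \sum_i c l * c i * ((x l == w)%:R * (x i == w)%:R).
Proof.
rewrite expr2 mulr_suml; apply: eq_bigr => l _; rewrite mulr_sumr.
by apply: eq_bigr => i _; ring.
Qed.

(** This controls the urn that a resampled ball leaves, whose position is correlated with the load;
    [sum_load] handles the urn that it enters. *)
Lemma sum_load_own : \sum_(k < n) \sum_(x : config) load (x k) x ^+ 2 <=
  N * (C2 + m^-1 * (2 * C1 ^+ 2 + n%:R * C2) + m^-1 ^+ 2 * (n%:R * C1 ^+ 2)).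
Proof.
have step k : \sum_(x : config) load (x k) x ^+ 2 <=
    N * (c k ^+ 2 + m^-1 * (2 * C1 * c k + C2) +
      m^-1 ^+ 2 * C1 ^+ 2).
  have -> : \sum_(x : config) load (x k) x ^+ 2 = \sum_l \sum_i c l * c i *
      \sum_(x : config) ((x l == x k)%:R * (x i == x k)%:R).
    under eq_bigr => x _ do rewrite load_sqr.
    rewrite exchange_big; apply: eq_bigr => l _.
    rewrite exchange_big; apply: eq_bigr => i _.
    by rewrite mulr_sumr.
  pose B l i := c l * c i * (N * ((l == k)%:R * (i == k)%:R +
    m^-1 * ((l == k)%:R + (i == k)%:R + (l == i)%:R) + m^-1 ^+ 2)).
  apply: (@le_trans _ _ (\sum_l \sum_i B l i)).
    apply: ler_sum => l _; apply: ler_sum => i _.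
    by rewrite ler_wpM2l ?mulr_ge0 ?c_ge0// prob_same_urn3.
  have pick (f : 'I_n -> R) j : \sum_i f i * (i == j)%:R = f j.
    rewrite (bigD1 j)//= eqxx mulr1 big1 ?addr0// => i /negPf ->.
    by rewrite mulr0.
  have inner l : \sum_i B l i = N * (c k * (c l * (l == k)%:R) +
      m^-1 * (C1 * (c l * (l == k)%:R) + c k * c l + c l ^+ 2) +
      m^-1 ^+ 2 * (C1 * c l)).
    transitivity (\sum_i (N * ((l == k)%:R * c l *
        (c i * (i == k)%:R) + m^-1 * ((l == k)%:R * c l * c i +
        c l * (c i * (i == k)%:R) +
        c l * (c i * (i == l)%:R)) +
        m^-1 ^+ 2 * (c l * c i)))).
      apply: eq_bigr => i _; rewrite /B [l == i]eq_sym.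
      by move: (l == k)%:R (i == k)%:R (i == l)%:R => *; ring.
    rewrite -mulr_sumr !big_split/= -!mulr_sumr !big_split/= -!mulr_sumr.
    rewrite !pick -/C1. by ring.
  under eq_bigr => l _ do rewrite inner.
  rewrite -mulr_sumr !big_split/= -!mulr_sumr !big_split/= -!mulr_sumr.
  rewrite !pick -/C1 -/C2.
  rewrite le_eqVlt; apply/orP; left; apply/eqP.
  by move: C1 C2 m^-1 N => ? ? ? ?; ring.
apply: (le_trans (ler_sum _ (fun k _ => step k))).
rewrite -mulr_sumr !big_split/= -!mulr_sumr !big_split/= -!mulr_sumr -/C1 -/C2.
rewrite !sumr_const card_ord -(mulr_natl C2 n) -(mulr_natl C1 n).
rewrite le_eqVlt; apply/orP; left; apply/eqP.
by move: C1 C2 m^-1 N => ? ? ? ?; ring.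
Qed.

Lemma sum_load : \sum_x \sum_v load v x ^+ 2 <= N * (C2 + m^-1 * C1 ^+ 2).
Proof.
have -> : \sum_x \sum_v load v x ^+ 2 = \sum_l \sum_i c l * c i *
    \sum_(x : config) (x l == x i)%:R.
  transitivity (\sum_(x : config) \sum_l \sum_i c l * c i * (x l == x i)%:R).
    apply: eq_bigr => x _; under eq_bigr => v _ do rewrite load_sqr.
    rewrite exchange_big; apply: eq_bigr => l _.
    rewrite exchange_big; apply: eq_bigr => i _.
    rewrite -mulr_sumr; congr (_ * _).
    rewrite (bigD1 (x i))//= eqxx mulr1 big1 ?addr0// => v vi.
    by rewrite [x i == v]eq_sym (negPf vi) mulr0.
  rewrite exchange_big; apply: eq_bigr => l _.
  rewrite exchange_big; apply: eq_bigr => i _.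
  by rewrite mulr_sumr.
pose B l i := N * (m^-1 * (c l * c i) +
  c l * (c i * (i == l)%:R)).
apply: (@le_trans _ _ (\sum_l \sum_i B l i)).
  apply: ler_sum => l _; apply: ler_sum => i _.
  rewrite prob_same_urn /B mulrCA ler_wpM2l// [l == i]eq_sym.
  have := c_ge0 l; have := c_ge0 i => ? ?.
  have : 0 <= c l * c i by rewrite mulr_ge0.
  have : 0 <= m^-1 by rewrite invr_ge0 ltW.
  rewrite [c l * (c i * _)]mulrA => mi0 cc0; have : 0 <= m^-1 * (c l * c i).
    by rewrite mulr_ge0.
  by case: eqP => _; rewrite ?mulr1 ?mulr0; lra.
have inner l : \sum_i B l i = N * (m^-1 * c l * C1 + c l ^+ 2).
  rewrite -mulr_sumr big_split/= -!mulr_sumr; congr (_ * _); congr (_ + _).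
    by rewrite mulrA.
  rewrite (bigD1 l)//= eqxx mulr1 big1 ?addr0 ?expr2// => i /negPf ->.
  by rewrite mulr0.
under eq_bigr => l _ do rewrite inner.
rewrite -mulr_sumr big_split/= -mulr_suml -mulr_sumr -/C1 -/C2.
rewrite le_eqVlt; apply/orP; left; apply/eqP.
by move: C1 C2 m^-1 N => ? ? ? ?; ring.
Qed.

End urn_load.

(** * The coupling of the whole count, and the variance of its drift *)

Section urn_drift.
Context {R : realFieldType} {n : nat} {V : finType}.
Local Notation config := {ffun 'I_n -> V}.
Local Notation m := (#|V|%:R : R).
Local Notation N := (#|{: config}|%:R : R).
Implicit Types (x : config) (i j k l : 'I_n) (v w : V).
Hypotheses (n_gt0 : (0 < n)%N) (V_gt1 : (1 < #|V|)%N).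
Local Notation weight := (@weight R n V).
Local Notation weight_max := (@weight_max R n V).
Local Notation crowded_prob := (@crowded_prob R n V).
Local Notation crowd := (@crowd R n V).
Local Notation crowded := (@crowded R n V).

Let m_gt0 : 0 < m. Proof. by rewrite ltr0n ltnW. Qed.
Let m_neq0 : m != 0. Proof. by rewrite gt_eqF. Qed.

Lemma crowd_coupling (F : config -> R) :
  \sum_x (crowd x - n%:R * crowded_prob) * F x =
  \sum_x \sum_(e : 'I_n * 'I_n)
    weight e.1 e.2 x * (F (move x e.2 (x e.1)) - F x).
Proof.
transitivity (\sum_i \sum_x (crowded x i - crowded_prob) * F x).
  rewrite exchange_big/=; apply: eq_bigr => x _; rewrite -mulr_suml sumrB.
  by rewrite sumr_const card_ord mulr_natl.
under eq_bigr => i _ do rewrite crowded_coupling//.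
rewrite exchange_big/=; apply: eq_bigr => x _.
by rewrite -(pair_big xpredT xpredT
  (fun i j => weight i j x * (F (move x j (x i)) - F x))).
Qed.

Lemma sum_weight_le x :
  \sum_(e : 'I_n * 'I_n) weight e.1 e.2 x <= n%:R * crowded_prob.
Proof.
rewrite -(pair_big xpredT xpredT (fun i j => weight i j x))/=.
apply: (@le_trans _ _ (\sum_i \sum_j weight_max i j)).
  by apply: ler_sum => i _; apply: ler_sum => j _; exact: weight_le.
under eq_bigr => i _ do rewrite sum_weight_max//.
by rewrite sumr_const card_ord mulr_natl.
Qed.

Definition drift x : R := \sum_(e : 'I_n * 'I_n)
  weight e.1 e.2 x * (crowd (move x e.2 (x e.1)) - crowd x).

Lemma weight_max_ge0 i j : 0 <= weight_max i j.
Proof.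
have [v _] : exists v : V, true by case/card_gt0P: (ltnW V_gt1) => v; exists v.
exact: le_trans (weight_ge0 V_gt1 i j [ffun=> v]) (weight_le V_gt1 _ _ _).
Qed.

(** The largest total weight of pairs involving ball [l], first as the ball being joined, then as
    the ball being moved. *)
Definition influence l := \sum_j weight_max l j + \sum_i weight_max i l.

Lemma influence_ge0 l : 0 <= influence l.
Proof. by rewrite addr_ge0// sumr_ge0// => i _; exact: weight_max_ge0. Qed.

(** The weight only asks which balls share the urn of [i], and ball [k] is outside that urn before
    and after its move. *)
Lemma weight_move_local i j k v x : x i \notin [:: x k; v] ->
  weight i j (move x k v) = weight i j x.
Proof.
rewrite !inE negb_or => /andP[ik iv].
have ki : k != i by apply: contraNneq ik => ->.
rewrite /weight; case: eqP => // _; congr (_ * (_ * _)); apply: eq_bigr => l _.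
rewrite /miss (move_other x v (_ : i != k)); last by rewrite eq_sym.
have [->|lk] := eqVneq l k; last by rewrite move_other.
by rewrite (negPf ki) move_at [v == _]eq_sym iv [x k == _]eq_sym ik.
Qed.

(** A pair contributes only if one of its balls sits in the old or new urn of [k]. Its two terms are
    then each at most [2 * weight_max i j], whence the factor 4. *)
Lemma drift_move_le x k v : `|drift x - drift (move x k v)| <=
  4 * \sum_l influence l * (x l \in [:: x k; v])%:R.
Proof.
pose e l : R := (x l \in [:: x k; v])%:R.
have -> : \sum_l influence l * e l = \sum_(p : 'I_n * 'I_n)
    weight_max p.1 p.2 * (e p.1 + e p.2).
  rewrite -(pair_big xpredT xpredT (fun i j => weight_max i j * (e i + e j)))/=.
  under [RHS]eq_bigr => i _ do under eq_bigr do rewrite mulrDr.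
  under [RHS]eq_bigr => i _ do rewrite big_split/= -mulr_suml.
  rewrite big_split/= [X in _ + X]exchange_big/= -big_split/=.
  by apply: eq_bigr => l _; rewrite /influence mulrDl !mulr_suml.
rewrite -sumrB; apply: (le_trans (ler_norm_sum _ _ _)); rewrite mulr_sumr.
apply: ler_sum => -[i j] _ /=; rewrite [leRHS]mulrCA mulrC.
have tle y : `|(crowd (move y j (y i)) - crowd y) * weight i j y| <=
    2 * weight_max i j.
  rewrite normrM; apply: ler_pM => //; first exact: crowd_move_le.
  by rewrite ger0_norm ?weight_ge0// weight_le.
have big : `|(crowd (move x j (x i)) - crowd x) * weight i j x -
   weight i j (move x k v) *
   (crowd (move (move x k v) j (move x k v i)) - crowd (move x k v))| <=
   4 * weight_max i j.
  apply: (le_trans (ler_normB _ _)); rewrite [X in _ + `|X|]mulrC.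
  by have := tle x; have := tle (move x k v); lra.
have w0 := weight_max_ge0 i j.
have [ei|ei] := boolP (x i \in [:: x k; v]).
  apply: (le_trans big); have -> : e i = 1 by rewrite /e ei.
  have : 0 <= weight_max i j * e j by rewrite mulr_ge0.
  by rewrite mulrCA mulrDr mulr1; lra.
have [ej|ej] := boolP (x j \in [:: x k; v]).
  apply: (le_trans big); have -> : e j = 1 by rewrite /e ej.
  have -> : e i = 0 by rewrite /e (negPf ei).
  by rewrite add0r mulr1 mulrC.
have ki : k != i by apply: contraNneq ei => ->; rewrite inE eqxx.
have kj : k != j by apply: contraNneq ej => ->; rewrite inE eqxx.
rewrite weight_move_local// crowd_move_local// mulrC subrr normr0.
by rewrite !mulr_ge0// addr_ge0.
Qed.

Let C1 : R := \sum_l influence l.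
Let C2 : R := \sum_l influence l ^+ 2.

Lemma sum_influence : C1 = 2 * (n%:R * crowded_prob).
Proof.
rewrite /C1 big_split/= [X in _ + X]exchange_big/=.
under eq_bigr => i _ do rewrite sum_weight_max//.
by rewrite sumr_const card_ord -mulr_natl; ring.
Qed.

Local Notation load := (@load R n V influence).

Lemma drift_variance_influence c : \sum_x drift x = N * c ->
  \sum_x (drift x - c) ^+ 2 <=
  32 * (N * (C2 + 2 * m^-1 * C1 ^+ 2 + 2 * n%:R * m^-1 * C2 +
    2 * n%:R * m^-1 ^+ 2 * C1 ^+ 2)).
Proof.
move=> /(efron_stein (ltnW V_gt1))/le_trans; apply.
(* The constant 32 is [4 ^+ 2 * 2], from squaring [drift_move_le] and splitting the square of a sum
   of two loads. *)
apply: (@le_trans _ _ (\sum_k m^-1 * \sum_(x : config) \sum_v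
    (32 * load (x k) x ^+ 2 + 32 * load v x ^+ 2))).
  apply: ler_sum => k _; rewrite ler_wpM2l ?invr_ge0 ?(ltW m_gt0)//.
  apply: ler_sum => x _; apply: ler_sum => v _.
  have le_load : `|drift x - drift (move x k v)| <= 4 * (load (x k) x + load v x).
    apply: (le_trans (drift_move_le _ _ _)); rewrite ler_wpM2l// -big_split/=.
    apply: ler_sum => l _; rewrite -mulrDr ler_wpM2l ?influence_ge0// !inE.
    by case: eqP; case: eqP => _ _ /=; lra.
  rewrite -(real_normK (num_real (drift x - _))).
  have := normr_ge0 (drift x - drift (move x k v)).
  move: le_load; move: (`|_|) (load _ _) (load _ _) => a b d le_a a0.
  have : a ^+ 2 <= (4 * (d + b)) ^+ 2 by rewrite !expr2 ler_pM.
  by have := sqr_ge0 (d - b); rewrite !expr2; lra.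
have -> : \sum_(k < n) m^-1 * (\sum_(x : config) \sum_v
    (32 * load (x k) x ^+ 2 + 32 * load v x ^+ 2)) =
    32 * (\sum_(k < n) \sum_(x : config) load (x k) x ^+ 2 +
      n%:R * m^-1 * \sum_x \sum_v load v x ^+ 2).
  rewrite mulrDr mulr_sumr.
  have -> : 32 * (n%:R * m^-1 * \sum_x \sum_v load v x ^+ 2) =
      \sum_(k < n) 32 * (m^-1 * \sum_x \sum_v load v x ^+ 2).
    by rewrite sumr_const card_ord -(mulr_natl _ n); ring.
  rewrite -big_split/=; apply: eq_bigr => k _.
  under eq_bigr => x _ do rewrite big_split/= sumr_const -(mulr_natl _ #|V|) -mulr_sumr.
  rewrite big_split/= mulrDr -!mulr_sumr; congr (_ + _); last by ring.
  by rewrite !mulrA mulVf// mul1r.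
rewrite ler_wpM2l//.
have nm0 : 0 <= n%:R * m^-1 by rewrite mulr_ge0// invr_ge0 ltW.
apply: (le_trans (lerD (sum_load_own (ltnW V_gt1) influence_ge0)
  (ler_wpM2l nm0 (sum_load (ltnW V_gt1) influence_ge0)))).
rewrite -/C1 -/C2 le_eqVlt; apply/orP; left; apply/eqP.
by move: C1 C2 m^-1 N => ? ? ? ?; ring.
Qed.

(** A Bernoulli-type inequality. For [y = n.-1%:R / m] it gives [y <= crowded_prob * (1 + y)], which
    trades a factor [y] for the crowding probability. *)
Lemma miss_prob_expr_le a : (@miss_prob R V) ^+ a * (1 + a%:R / m) <= 1.
Proof.
elim: a => [|a IH]; first by rewrite mul0r addr0 mulr1.
apply: le_trans IH; rewrite exprSr -mulrA ler_wpM2l//.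
  by rewrite exprn_ge0// ltW// miss_prob_gt0.
have mi0 : 0 <= m^-1 by rewrite invr_ge0 ltW.
have a0 : 0 <= a%:R :> R by [].
rewrite /miss_prob -natr1; move: m^-1 (a%:R) mi0 a0 => u b *.
by nra.
Qed.

Lemma crowded_prob_ge0 : 0 <= crowded_prob.
Proof.
rewrite subr_ge0 exprn_ile1// ?miss_prob_le1//.
by rewrite ltW// miss_prob_gt0.
Qed.

(** With [X = n%:R / m], the constants round up 32 times [(14 / 3 + 8 / 3 * X) * (1 + 2 * X) + 8 * X
    + 8 * X ^+ 2]. *)
Lemma drift_variance c : (4 <= #|V|)%N -> \sum_x drift x = N * c ->
  \sum_x (drift x - c) ^+ 2 <= N * (n%:R * crowded_prob ^+ 2 *
    (150 + 640 * (n%:R / m) + 427 * (n%:R / m) ^+ 2)).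
Proof.
move=> V4 /drift_variance_influence/le_trans; apply.
set L := crowded_prob; have L0 : 0 <= L by exact: crowded_prob_ge0.
set X := n%:R / m; have X0 : 0 <= X by rewrite divr_ge0// ltW.
pose rho l := \sum_i weight_max i l.
have rho0 l : 0 <= rho l by apply: sumr_ge0 => i _; exact: weight_max_ge0.
(* At least four urns give [q >= 3 / 4], so each of the [n.-1] off-diagonal entries is at most
   [4 / 3 * m^-1]. *)
have rhole l : rho l <= 4 / 3 * (L * (1 + X)).
  apply: (@le_trans _ _ (\sum_(i | i != l) (4 / 3 * m^-1))).
    rewrite /rho (bigD1 l)//= {1}/weight_max eqxx add0r; apply: ler_sum => i il.
    have q34 : 3 / 4 <= @miss_prob R V.
      have : m^-1 <= 4^-1 by rewrite lef_pV2 ?posrE// (ler_nat _ 4).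
      by rewrite /miss_prob; lra.
    have q0 : 0 < @miss_prob R V by exact: miss_prob_gt0.
    rewrite /weight_max (negPf il) invfM mulrC mulrCA [leRHS]mulrC.
    rewrite ler_wpM2l ?invr_ge0 ?(ltW m_gt0)//.
    apply: (@le_trans _ _ (1 * (@miss_prob R V)^-1)).
      rewrite ler_wpM2r ?invr_ge0 ?(ltW q0)// mulr_ile1 ?exprn_ge0 ?(ltW q0)//.
      - by apply: prodr_ge0 => k _; case: ifP => // _; exact: ltW.
      - by rewrite exprn_ile1 ?(ltW q0)// miss_prob_le1.
      - apply: prodr_ile1 => k _; case: ifP => _; rewrite ?ler01 ?lexx//.
        by rewrite (ltW q0) miss_prob_le1.
    by rewrite ler_pdivrMr//; lra.
  rewrite sumr_const -[_ *+ _]mulr_natl mulrCA ler_wpM2l//.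
  have -> : #|[pred i | i != l]| = n.-1 by rewrite cardC1 card_ord.
  have := miss_prob_expr_le n.-1; rewrite /L /crowded_prob.
  have le_X : n.-1%:R / m <= X.
    by rewrite ler_wpM2r ?invr_ge0 ?(ltW m_gt0)// ler_nat leq_pred.
  have L0' := L0; rewrite /L /crowded_prob in L0'.
  have y0 : 0 <= n.-1%:R / m by rewrite divr_ge0// ltW.
  move: (miss_prob ^+ _) (n.-1%:R / m) L0' le_X y0 => Q y *.
  by nra.
(* Only one factor of [rho l ^+ 2] is bounded by its maximum; the other is summed exactly, to
   [n%:R * L]. *)
have C2le : C2 <= n%:R * L ^+ 2 * (14 / 3 + 8 / 3 * X).
  apply: (@le_trans _ _ (\sum_l (2 * L ^+ 2 + 2 * (4 / 3 * (L * (1 + X))) * rho l))).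
    apply: ler_sum => l _; rewrite /influence sum_weight_max// -/L -/(rho l).
    have := rho0 l; have := rhole l; move: (rho l) (4 / 3 * _) => r B *.
    have : r * r <= B * r by rewrite ler_wpM2r.
    by have := sqr_ge0 (L - r); rewrite !expr2; lra.
  rewrite big_split/= sumr_const card_ord -(mulr_natl (2 * L ^+ 2) n) -mulr_sumr.
  have -> : \sum_l rho l = n%:R * L.
    rewrite exchange_big/=; under eq_bigr => i _ do rewrite sum_weight_max//.
    by rewrite sumr_const card_ord mulr_natl.
  by rewrite le_eqVlt; apply/orP; left; apply/eqP; field.
have n0 : 0 < n%:R :> R by rewrite ltr0n.
rewrite sum_influence -/L mulrCA ler_wpM2l//.
have -> : m^-1 = X / n%:R by rewrite /X; field; rewrite !gt_eqF.
have -> : 32 * (C2 + 2 * (X / n%:R) * (2 * (n%:R * L)) ^+ 2 +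
    2 * n%:R * (X / n%:R) * C2 + 2 * n%:R * (X / n%:R) ^+ 2 * (2 * (n%:R * L)) ^+ 2) =
    32 * (C2 * (1 + 2 * X) + n%:R * L ^+ 2 * (8 * X + 8 * X ^+ 2)).
  by field; rewrite gt_eqF.
have A0 : 0 <= n%:R * L ^+ 2 by rewrite mulr_ge0// sqr_ge0.
have : C2 * (1 + 2 * X) <= n%:R * L ^+ 2 * (14 / 3 + 8 / 3 * X) * (1 + 2 * X).
  by rewrite ler_wpM2r// addr_ge0// mulr_ge0.
move: (n%:R * L ^+ 2) A0 => A A0 le_A.
have AX : 0 <= A * X by rewrite mulr_ge0.
have AXX : 0 <= A * X ^+ 2 by rewrite mulr_ge0// sqr_ge0.
by rewrite !expr2 in AXX *; lra.
Qed.

End urn_drift.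

(** * Reduction to configurations *)

Section uniform_configurations.
Context d (T : measurableType d) (R : realType) (P : probability T R).
Variables (n m : nat) (X : 'I_n -> {RV P >-> nat}).
Hypotheses (X_indep : mutually_independent X)
  (X_unif : forall i, uniform_on m (X i)).
Hypothesis m_gt0 : (0 < m)%N.
Local Notation config := {ffun 'I_n -> 'I_m}.
Implicit Types (c : config) (w : T) (i j : 'I_n).
Local Notation N := (#|{: config}|%:R : R).

(** The successor matches ordinals counted from 0 with urns numbered from 1. *)
Definition config_event c : set T := [set w | forall i, X i w = (c i).+1].

Let config_eventE c : config_event c =
  \bigcap_(i in [set` [set: 'I_n]%SET]) (X i @^-1` [set (c i).+1]).
Proof.
apply/seteqP; split => [w Xw i _|w Xw i]; first exact: Xw.
by apply: Xw; rewrite /= inE.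
Qed.

Lemma measurable_config_event c : measurable (config_event c).
Proof.
rewrite config_eventE; apply: fin_bigcap_measurable => //.
by move=> i _; rewrite -[X in measurable X]setTI; exact: measurable_funP.
Qed.

Lemma prob_config_event c : P (config_event c) = (N^-1)%:E.
Proof.
rewrite config_eventE X_indep => [|//].
rewrite (eq_bigr (fun=> (m%:R^-1)%:E)) => [|i _]; last first.
  have := X_unif i (c i).+1; rewrite /distribution /pushforward => ->.
  by rewrite ltnS leq0n/= ltn_ord.
rewrite prodEFin prodr_const cardsT card_ord; congr EFin.
by rewrite exprVn card_ffun !card_ord natrX.
Qed.

Lemma trivIset_config_event : trivIset [set: config] config_event.
Proof.
apply/trivIsetP => c c' _ _ /eqP cc'; apply/seteqP; split => // w [/= cw c'w].
apply: cc'; apply/ffunP => i; apply: val_inj; apply: succn_inj.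
by rewrite -cw -c'w.
Qed.

(** The balls may leave the [m] urns on a null set, so these events exhaust [T] only up to
    probability 0. *)
Let covered := \big[setU/set0]_(c <- index_enum {: config}) config_event c.

Let measurable_covered : measurable covered.
Proof. by apply: bigsetU_measurable => c _; exact: measurable_config_event. Qed.

Let N_neq0 : N != 0.
Proof. by rewrite pnatr_eq0 -lt0n card_ffun !card_ord expn_gt0 m_gt0. Qed.

Let integral_covered (Y : T -> R) (G : config -> R) : measurable_fun setT Y ->
  (forall c w, config_event c w -> Y w = G c) ->
  (\int[P]_(w in covered) (Y w)%:E = (\sum_c N^-1 * G c)%:E)%E.
Proof.
move=> mY YG; rewrite integral_bigsetU_EFin//.
- rewrite -sumEFin; apply: eq_bigr => c _.
  rewrite (eq_integral (cst (G c)%:E)); last first.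
    by move=> w; rewrite inE => /YG ->.
  rewrite integral_cst; last exact: measurable_config_event.
  by rewrite [X in (_ * X)%E](prob_config_event c) -EFinM mulrC.
- exact: measurable_config_event.
- exact: index_enum_uniq.
- exact: sub_trivIset trivIset_config_event.
- by apply/measurable_EFinP; exact: measurable_funTS.
Qed.

Let prob_uncovered : P (~` covered) = 0%E.
Proof.
have := @integral_covered (cst 1) (cst 1) (measurable_cst _) (fun _ _ _ => erefl).
rewrite [X in X = _](_ : _ = P covered); last first.
  by rewrite -[RHS]mul1e; exact: (integral_cst P measurable_covered 1%E).
rewrite -mulr_suml sumr_const -(mulr_natr _ #|_|) mulVf// mulr1 => P1.
by rewrite probability_setC// P1 subee.
Qed.

Lemma expectation_config (Y : T -> R) (G : config -> R) :
  measurable_fun setT Y -> (forall c w, config_event c w -> Y w = G c) ->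
  'E_P[Y]%E = (\sum_c N^-1 * G c)%:E.
Proof.
move=> mY YG; rewrite -(integral_covered mY YG) integral_mkcond unlock.
apply: ae_eq_integral => //.
- exact/measurable_EFinP.
- apply/(measurable_restrictT _ _).1 => //.
  by apply/measurable_EFinP; exact: measurable_funTS.
exists (~` covered); split => //; first exact: measurableC.
move=> w /= neq cw; apply: neq => _; rewrite patchE.
by rewrite mem_set.
Qed.

Lemma probability_config (B : set T) (G : config -> bool) :
  measurable B -> (forall c w, config_event c w -> B w <-> G c) ->
  P B = (\sum_c N^-1 * (G c)%:R)%:E.
Proof.
move=> mB BG; rewrite -expectation_indic//.
apply: expectation_config => // c w cw; rewrite indicE; congr (nat_of_bool _)%:R.
by apply/idP/idP; rewrite inE => /(BG c w cw).
Qed.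

Lemma variance_config (Y : T -> R) (G : config -> R) :
  measurable_fun setT Y -> (forall c w, config_event c w -> Y w = G c) ->
  'V_P[Y]%E = (\sum_c N^-1 * (G c - \sum_c' N^-1 * G c') ^+ 2)%:E.
Proof.
move=> mY YG; rewrite /variance unlock (expectation_config mY YG)/=.
apply: expectation_config; last by move=> c w /YG /= <-; rewrite expr2.
by apply: measurable_funM; apply: measurable_funB.
Qed.

End uniform_configurations.

Section non_isolated_configurations.
Context d (T : measurableType d) (R : realType) (P : probability T R).
Variables (n m : nat) (X : 'I_n -> {RV P >-> nat}).

(** Casting the integer count to [R] makes the measurability of real sums applicable. *)
Lemma non_isolatedE w : non_isolated X R w =
  \sum_i (1 < \sum_j (X j w == X i w)%:R :> R)%R%:R.
Proof.
apply: eq_bigr => i _; congr (_%:R); congr nat_of_bool.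
rewrite /cohabitants -(ltrD2l 1) addr0 addrA subrr add0r.
by rewrite -(ltr_int R) rmorph_sum/=; congr (_ < _); apply: eq_bigr.
Qed.

Lemma measurable_non_isolated : measurable_fun setT (non_isolated X R).
Proof.
have -> : non_isolated X R = fun w => \sum_i (1 < \sum_j (X j w == X i w)%:R :> R)%R%:R.
  by apply/funext => w; exact: non_isolatedE.
have mb (f : T -> bool) : measurable_fun setT f ->
    measurable_fun setT (fun w => (f w)%:R : R).
  by move=> mf; apply: (measurableT_comp (f := fun b : bool => b%:R : R)).
apply: measurable_sum => i.
refine (mb (fun w => (1 < \sum_j (X j w == X i w)%:R :> R)%R) _).
apply: measurable_fun_ltr => //; apply: measurable_sum => j.
refine (mb (fun w => X j w == X i w) _); apply: measurable_fun_eqn.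
  exact: measurable_funP.
exact: measurable_funP.
Qed.

Lemma non_isolated_config (c : {ffun 'I_n -> 'I_m}) w : config_event X c w ->
  non_isolated X R w = crowd c.
Proof.
move=> cw; rewrite non_isolatedE; apply: eq_bigr => i _.
congr (_%:R); congr nat_of_bool; rewrite -natr_sum ltr1n /occ.
congr (_ < _)%N; apply: eq_bigr => j _; rewrite !cw eqSS.
by [].
Qed.

End non_isolated_configurations.

(** * Assembling the final bound *)

Lemma urn_eta_ge (R : realType) (n m : nat) : (0 < n)%N -> (4 <= m)%N ->
  (16 + 48 * (n%:R / m%:R) + 48 * (n%:R / m%:R) ^+ 2) / n%:R <= urn_eta R n m.
Proof.
move=> n0 m4.
have nR : 1 <= n%:R :> R by rewrite ler1n.
have mR : 4 <= m%:R :> R by rewrite (ler_nat _ 4).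
have m3 : 0 < m%:R - 3 :> R by lra.
have nm : n%:R / m%:R <= n%:R / (m%:R - 3) :> R.
  by rewrite ler_wpM2l// lef_pV2 ?posrE//; lra.
(* For [n = 1] the denominator is 0 and the quotient is 0 by convention. *)
have e0 : 0 <= 4 / (n%:R * (n%:R - 1)) :> R.
  by rewrite divr_ge0// mulr_ge0 ?subr_ge0.
have : 24 / m%:R * (2 + n%:R / m%:R + n%:R / m%:R) <=
    24 / m%:R * (2 + n%:R / (m%:R - 3) + n%:R / m%:R) :> R.
  by rewrite ler_wpM2l// ?divr_ge0//; lra.
rewrite /urn_eta.
have -> : (16 + 48 * (n%:R / m%:R) + 48 * (n%:R / m%:R) ^+ 2) / n%:R =
    16 / n%:R + 24 / m%:R * (2 + n%:R / m%:R + n%:R / m%:R) :> R.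
  by field; rewrite !gt_eqF//; lra.
by lra.
Qed.

Theorem theorem1 (R : realType) (d : measure_display) (T : measurableType d)
    (P : probability T R) (n m : nat) (X : 'I_n -> {RV P >-> nat})
    (m_ge4 : (4 <= m)%N)
    (X_indep : mutually_independent X)
    (X_unif : forall i, uniform_on m (X i)) :
  let Y : T -> R := non_isolated X R in
  let mu := mean P Y in
  let sigma := sd P Y in
  0 < sigma -> 24 * mu <= sigma ^+ 3 ->
  normal_discrepancy P Y <=
    8 / 10 / sigma +
    mu / sigma ^+ 2 *
      (256 / sigma + 32 / sigma ^+ 2 + 23 * Num.sqrt (urn_eta R n m)).
Proof.
move=> Y mu sigma sigma_gt0 _.
have m_gt0 : (0 < m)%N by exact: leq_trans m_ge4.
pose N : R := #|{: {ffun 'I_n -> 'I_m}}|%:R.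
pose Z (c : {ffun 'I_n -> 'I_m}) : R := crowd c.
have YZ (c : {ffun 'I_n -> 'I_m}) w : config_event X c w -> Y w = Z c.
  exact: non_isolated_config.
have mY : measurable_fun setT Y by exact: measurable_non_isolated.
have N_gt0 : 0 < N by rewrite ltr0n card_ffun !card_ord expn_gt0 m_gt0.
have N_neq0 : N != 0 by rewrite gt_eqF.
have muE : mu = \sum_c N^-1 * Z c.
  by rewrite /mu /mean (expectation_config X_indep X_unif m_gt0 mY YZ).
have sigma2 : \sum_c N^-1 * (Z c - mu) ^+ 2 = sigma ^+ 2.
  rewrite /sigma /sd (variance_config X_indep X_unif m_gt0 mY YZ)/= -muE sqr_sqrtr//.
  by apply: sumr_ge0 => c _; rewrite mulr_ge0 ?invr_ge0 ?ler0n// sqr_ge0.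
have n_gt0 : (0 < n)%N.
  rewrite lt0n; apply/eqP => n0; move: sigma_gt0.
  have Z0 c : Z c = 0 by rewrite /Z /crowd big1// => i; have := ltn_ord i; rewrite {2}n0.
  suff : sigma ^+ 2 = 0 by move/eqP; rewrite sqrf_eq0 => /eqP ->; rewrite ltxx.
  rewrite -sigma2 muE; apply: big1 => c _.
  by rewrite [\sum_c _]big1 ?Z0 ?subr0 ?expr0n ?mulr0// => c' _; rewrite Z0 mulr0.
have V_gt1 : (1 < #|'I_m|)%N by rewrite card_ord; exact: leq_trans m_ge4.
set lam : R := @crowded_prob R n 'I_m.
have sum_drift (F : {ffun 'I_n -> 'I_m} -> R) : \sum_c (Z c - n%:R * lam) * F c =
    \sum_c \sum_(e : 'I_n * 'I_n)
      weight e.1 e.2 c * (F (move c e.2 (c e.1)) - F c).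
  exact: crowd_coupling.
(* A constant [F] in the coupling identity identifies the mean; [F = Z] will give the mean of the
   drift. *)
have mu_lam : mu = n%:R * lam.
  have := sum_drift (cst 1); rewrite [RHS]big1 => [|c _]; last first.
    by rewrite big1// => e _; rewrite subrr mulr0.
  under eq_bigr do rewrite mulr1; rewrite sumrB sumr_const => /eqP.
  rewrite subr_eq0 -(mulr_natl _ #|_|) => /eqP E.
  by rewrite muE -mulr_sumr E mulrA mulVf// mul1r.
rewrite -mu_lam in sum_drift.
have drift_mean : \sum_(c : {ffun 'I_n -> 'I_m}) drift c = N * sigma ^+ 2.
  rewrite -sigma2 mulr_sumr.
  transitivity (\sum_(c : {ffun 'I_n -> 'I_m}) (Z c - mu) * (Z c - mu)).
    rewrite sum_drift; apply: eq_bigr => c _; rewrite /drift; apply: eq_bigr => e _.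
    by congr (_ * _); rewrite /Z; ring.
  by apply: eq_bigr => c _; rewrite mulrA mulfV// mul1r expr2.
pose W c := (Z c - mu) / sigma.
pose b (e : 'I_n * 'I_n) (c : {ffun 'I_n -> 'I_m}) : R := weight e.1 e.2 c / sigma.
pose W' (e : 'I_n * 'I_n) c := W (move c e.2 (c e.1)).
pose V := \sum_c N^-1 * (1 - \sum_e b e c * (W' e c - W c)) ^+ 2.
have V_le : V <= (4 * mu / sigma ^+ 2) ^+ 2 * urn_eta R n m.
  have -> : V = (sigma ^+ 4)^-1 * (N^-1 *
      \sum_(c : {ffun 'I_n -> 'I_m}) (drift c - sigma ^+ 2) ^+ 2).
    rewrite 2!mulr_sumr; apply: eq_bigr => c _.
    have -> : \sum_e b e c * (W' e c - W c) = drift c / sigma ^+ 2.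
      rewrite /drift mulr_suml; apply: eq_bigr => e _.
      by rewrite /b /W' /W /Z; field; rewrite gt_eqF.
    by field; rewrite N_neq0 gt_eqF.
  have m4 : (4 <= #|'I_m|)%N by rewrite card_ord.
  have := drift_variance n_gt0 V_gt1 m4 drift_mean.
  rewrite -ler_pdivrMl// card_ord -/lam => vle.
  apply: (le_trans (ler_wpM2l _ vle)); first by rewrite invr_ge0 exprn_ge0// ltW.
  have x0 : 0 <= n%:R / m%:R :> R by [].
  have nR : 0 < n%:R :> R by rewrite ltr0n.
  apply: (@le_trans _ _ ((4 * mu / sigma ^+ 2) ^+ 2 *
      ((16 + 48 * (n%:R / m%:R) + 48 * (n%:R / m%:R) ^+ 2) / n%:R))); last first.
    by rewrite ler_wpM2l ?sqr_ge0// urn_eta_ge.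
  rewrite mu_lam; set x := n%:R / m%:R in x0 *.
  have -> : (4 * (n%:R * lam) / sigma ^+ 2) ^+ 2 *
      ((16 + 48 * x + 48 * x ^+ 2) / n%:R) =
      (sigma ^+ 4)^-1 * (n%:R * lam ^+ 2 * (16 * (16 + 48 * x + 48 * x ^+ 2))).
    by field; rewrite !gt_eqF.
  rewrite ler_wpM2l ?invr_ge0 ?exprn_ge0 ?(ltW sigma_gt0)//.
  rewrite ler_wpM2l ?mulr_ge0 ?exprn_ge0 ?crowded_prob_ge0//.
  (* Here 150, 640 and 427 are compared with 256, 768 and 768. *)
  by have := sqr_ge0 x; lra.
set D := normal_discrepancy P Y.
have cdfE t : fine (P [set w | (Y w - mu) / sigma <= t]) =
    finite_cdf (fun=> N^-1) W t.
  rewrite (probability_config X_indep X_unif m_gt0 (G := fun c => W c <= t)).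
  - by [].
  - have mW : measurable_fun setT (fun w => (Y w - mu) / sigma).
      by apply: measurable_funM => //; apply: measurable_funB.
    have := mW measurableT _ (measurable_itv `]-oo, t]); rewrite setTI.
    by congr measurable; apply/seteqP; split => w; rewrite /= in_itv.
  - by move=> c w /YZ YE; rewrite /= YE.
(* Without an upper bound [sup] would return a default value. *)
have D_sup : has_sup [set `|fine (P [set w | (Y w - mu) / sigma <= t]) -
    std_normal_cdf t| | t in [set: R]].
  split; first by exists `|fine (P [set w | (Y w - mu) / sigma <= 0]) -
    std_normal_cdf 0|; exists 0.
  exists 2 => _ [t _ <-].
  have c0 := std_normal_cdf_ge0 t; have c1 := std_normal_cdf_le1 t.
  apply: (le_trans (ler_normB _ _)); rewrite [X in _ + X]ger0_norm//.
  have -> : (2 : R) = 1 + 1 by [].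
  apply: lerD => //; rewrite cdfE ger0_norm.
    apply: (@le_trans _ _ (\sum_(c : {ffun 'I_n -> 'I_m}) N^-1)).
      apply: ler_sum => c _; rewrite ler_piMr ?invr_ge0 ?(ltW N_gt0)//.
      by case: (W c <= t); rewrite ?lexx ?ler01.
    by rewrite sumr_const -(mulr_natr _ #|_|) mulVf.
  by apply: sumr_ge0 => c _; rewrite mulr_ge0 ?invr_ge0 ?(ltW N_gt0).
have D_ge t : `|finite_cdf (fun=> N^-1) W t - std_normal_cdf t| <= D.
  rewrite -cdfE; apply: (ub_le_sup D_sup.2); by exists t.
have mu_ge0 : 0 <= mu.
  rewrite muE; apply: sumr_ge0 => c _.
  by rewrite mulr_ge0 ?invr_ge0 ?(ltW N_gt0)// sumr_ge0.
have D_le : D <= D / 2 + (14 * (mu / sigma * (2 / sigma) ^+ 2) + 2 * Num.sqrt V).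
  apply: ge_sup; first exact: D_sup.1.
  move=> _ [t _ <-]; rewrite cdfE.
  apply: (@finite_cdf_discrepancy R _ _ (fun=> N^-1) W b W' (mu / sigma) (2 / sigma)).
  - by move=> c; rewrite invr_ge0 ltW.
  - by rewrite sumr_const -(mulr_natr _ #|_|) mulVf.
  - by move=> e c; rewrite divr_ge0 ?(ltW sigma_gt0)// weight_ge0.
  - move=> c; rewrite -mulr_suml ler_wpM2r ?invr_ge0 ?(ltW sigma_gt0)//.
    by rewrite mu_lam; exact: sum_weight_le.
  - move=> e c; rewrite /W' /W -mulrBl opprB addrA subrK normrM normfV.
    rewrite (gtr0_norm sigma_gt0) ler_wpM2r ?invr_ge0 ?(ltW sigma_gt0)//.
    exact: crowd_move_le.
  - move=> f; transitivity (N^-1 / sigma * \sum_c (Z c - mu) * f (W c)).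
      by rewrite mulr_sumr; apply: eq_bigr => c _; rewrite /W; ring.
    rewrite (sum_drift (f \o W)) mulr_sumr; apply: eq_bigr => c _.
    rewrite -mulrA; congr (_ * _); rewrite mulr_sumr; apply: eq_bigr => e _.
    by rewrite /b /=; ring.
  - transitivity (sigma ^- 2 * \sum_c N^-1 * (Z c - mu) ^+ 2).
      by rewrite mulr_sumr; apply: eq_bigr => c _; rewrite /W expr_div_n; ring.
    by rewrite sigma2 mulVf// expf_neq0// gt_eqF.
  - by rewrite divr_gt0.
  - exact: D_ge.
have sqrtV : Num.sqrt V <= 4 * mu / sigma ^+ 2 * Num.sqrt (urn_eta R n m).
  apply: (le_trans (ler_wsqrtr V_le)).
  rewrite sqrtrM ?sqr_ge0// sqrtr_sqr ger0_norm//.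
  by rewrite divr_ge0 ?mulr_ge0 ?exprn_ge0 ?(ltW sigma_gt0).
have a0 : 0 <= mu / sigma ^+ 2 by rewrite divr_ge0 ?exprn_ge0 ?(ltW sigma_gt0).
have s0 : 0 <= sigma^-1 by rewrite invr_ge0 ltW.
have h0 := sqrtr_ge0 (urn_eta R n m).
rewrite (_ : mu / sigma * (2 / sigma) ^+ 2 = 4 * (mu / sigma ^+ 2 * sigma^-1)) in D_le; last first.
  by field; rewrite gt_eqF.
rewrite (_ : 4 * mu / sigma ^+ 2 = 4 * (mu / sigma ^+ 2)) in sqrtV; last by ring.
have as0 : 0 <= mu / sigma ^+ 2 * sigma^-1 by rewrite mulr_ge0.
have ah0 : 0 <= mu / sigma ^+ 2 * Num.sqrt (urn_eta R n m) by rewrite mulr_ge0.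
have ass0 : 0 <= mu / sigma ^+ 2 * sigma ^- 2.
  by rewrite mulr_ge0// invr_ge0 exprn_ge0// ltW.
(* Absorbing [D / 2] leaves [112 * (mu / sigma ^+ 3)] plus [16 * (mu / sigma ^+ 2)] times the root
   of [urn_eta], within the constants 256 and 23. *)
rewrite !mulrDr.
move: (mu / sigma ^+ 2) (sigma^-1) (sigma ^- 2) (Num.sqrt V) (Num.sqrt (urn_eta R n m))
  a0 s0 h0 as0 ah0 ass0 D_le sqrtV => A S S2 v h; lra.
Qed.
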